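(* Let $\mathbf{r}=(r_1,\dots,r_n)$ be a sequence of integers with $1\le r_1\le\cdots\le r_n\le n$ and $r_k\ge k$ for all $k$. Let $\sigma_0\in B_{\mathbf r}$ with $\sigma_0(k)>0$ for all $k>0$. Then \[ \sum_{\sigma\in B_{\mathbf r}} q^{\mathrm{sor}_{\mathbf r}(\sigma,\sigma_0)}\prod_{i\in\mathrm{Cyc}_0(\sigma\sigma_0^{-1})}t_i=\sum_{\sigma\in B_{\mathbf r}} q^{\mathrm{inv}_B(\sigma)}\prod_{i\in\mathrm{Prlminl}(\sigma)}t_i=\prod_{k=1}^n\left(t_k+q[h_k-1]_q+q^{2k-h_k}[h_k]_q\right), \] where $(h_1,\dots,h_n)$ is the height sequence of the Dyck path $D(\mathbf r)$.
   Context: Here $q,t_1,\dots,t_n$ are indeterminates and $[m]_q=1+q+\cdots+q^{m-1}$ ($[0]_q=0$). Permutations are composed as functions, $(\sigma\tau)(i)=\sigma(\tau(i))$. **Signed permutations.** $B_n$ is the group of bijections $\sigma$ of $\{\pm1,\dots,\pm n\}$ with $\sigma(-i)=-\sigma(i)$; $\bar a$ means $-a$. $B_{\mathbf r}=\{\sigma\in B_n:|\sigma(k)|\le r_k,\ 1\le k\le n\}$. With $N(\sigma)=|\{1\le i\le n:\sigma(i)<0\}|$, \[\mathrm{inv}_B(\sigma)=|\{1\le i<j\le n:\sigma(i)>\sigma(j)\}|+|\{1\le i<j\le n:-\sigma(i)>\sigma(j)\}|+N(\sigma).\] $\mathrm{Prlminl}(\sigma)$ (positive right-to-left minimum letters)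 is $\{\sigma(k):1\le k\le n,\ 0<\sigma(k)<|\sigma(l)|\text{ for all }k<l\le n\}$. A signed permutation decomposes into cycles of two kinds: balanced cycles $(a_1,\dots,a_k)$ (which also take $\bar a_1$ to $\bar a_2$, etc.; a cycle and its negative count as one), and unbalanced cycles $(a_1,\dots,a_k,\bar a_1,\dots,\bar a_k)$, where $k\ge1$ and $|a_1|,\dots,|a_k|$ are distinct. $\mathrm{Cyc}_0(\sigma)$ is the set of the minimal absolute values of elements in the balanced cycles of $\sigma$, one for each balanced cycle. **Dyck paths and bicolored matchings.** A Dyck path of semilength $n$ is a lattice path from $(0,0)$ to $(2n,0)$ with steps $(1,1)$ (rises) and $(1,-1)$ (falls) never going below the $x$-axis. The height of a rise is the $y$-coordinate of its right endpoint; the height sequence $(h_1,\dots,h_n)$ lists the heights of the rises from left to right. $D(\mathbf r)$ is the unique Dyck path of semilength $n$ whose $k$-th fall is preceded by exactly $r_k$ rises, for every $k$. A (perfect) matching on $\{1,\dots,2n\}$ is a partition into $n$ two-element blocks (edges); an edge $i\cdot j$ with $i<j$ has opener $i$ and closer $j$; $M(v)$ is the vertex in the same block as $v$. $M$ has type $D$ if, for each $v$, $v$ is an opener iff the $v$-th step of $D$ is a rise. $\mathcal M_n^{(2)}(D)$ is the set of matchings of type $D$ with each edge colored red or blue. Openers are $o_1<\cdots<o_n$, closers $c_1<\cdots<c_n$. $\mathrm{col}(v,M)=0$ if the edge at $v$ is red, $1$ if blue. **Sorting index of bicolored matchings.** Let $M\in\mathcal M_n^{(2)}(D)$ and let $M_0\in\mathcal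 M_n^{(2)}(D)$ have only red edges. Define $M_n=M,M_{n-1},\dots,M_1$: if $M_k(o_k)=M_0(o_k)$, then $M_{k-1}$ has the same edges and colors as $M_k$ except that the edge at $o_k$ is red. Otherwise replace the edges $o_k\cdot M_k(o_k)$ and $M_k(M_0(o_k))\cdot M_0(o_k)$ of $M_k$ by $o_k\cdot M_0(o_k)$ and $M_k(M_0(o_k))\cdot M_k(o_k)$, with $\mathrm{col}(o_i,M_{k-1})=\mathrm{col}(o_i,M_k)+\mathrm{col}(o_k,M_k)\pmod 2$ if $o_i\in\{o_k,M_k(M_0(o_k))\}$ and $\mathrm{col}(o_i,M_{k-1})=\mathrm{col}(o_i,M_k)$ otherwise. Let $a_k=|\{c:c>o_k,\ c\in[M_k(o_k),M_0(o_k)],\ M_0(c)<o_k\}|$ if $M_k(o_k)\le M_0(o_k)$ and $a_k=|\{c:c>o_k,\ c\notin(M_0(o_k),M_k(o_k)),\ M_0(c)<o_k\}|$ if $M_0(o_k)<M_k(o_k)$. Put $\mathrm{sor}_k(M,M_0)=a_k$ if $\mathrm{col}(o_k,M_k)=0$ and $\mathrm{sor}_k(M,M_0)=2k-1-a_k$ if $\mathrm{col}(o_k,M_k)=1$; $\mathrm{sor}(M,M_0)=\sum_{k=1}^n\mathrm{sor}_k(M,M_0)$. **The statistic $\mathrm{sor}_{\mathbf r}$.** The bijection $g_{\mathbf r}:B_{\mathbf r}\to\mathcal M_n^{(2)}(D(\mathbf r))$ sends $\sigma$ to the matching with edges $o_{|\sigma(k)|}\cdot c_k$, $1\le k\le n$,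 colored red if $\sigma(k)>0$ and blue if $\sigma(k)<0$. For $\sigma,\sigma_0\in B_{\mathbf r}$ with $\sigma_0(k)>0$ for all $k>0$, $\mathrm{sor}_{\mathbf r}(\sigma,\sigma_0)=\mathrm{sor}(g_{\mathbf r}(\sigma),g_{\mathbf r}(\sigma_0))$. *)

(* Defs.v *)
From HB Require Import structures.
From mathcomp Require Import all_boot all_order all_algebra all_fingroup.
From mathcomp Require Import zify.

Set Implicit Arguments.
Unset Strict Implicit.
Unset Printing Implicit Defensive.

Import Order.TTheory GRing.Theory Num.Theory.

(* All indices are 0-based: k : 'I_n stands for the index k + 1 in {1, ..., n},
   and v : 'I_(n + n) for the vertex (or step) v + 1 in {1, ..., 2n}. *)

(* (false, i) is the letter i + 1 and (true, i) the letter - (i + 1); x.2 is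
   thus the absolute value of the letter x. *)
Notation letter n := (bool * 'I_n)%type.

Section SignedPermutations.
Variable n : nat.
Local Notation letter := (letter n).

Definition pos (k : 'I_n) : letter := (false, k).
Definition neg (x : letter) : letter := (~~ x.1, x.2).
Definition ival (x : letter) : int :=
  (if x.1 then - (x.2.+1)%:Z else (x.2.+1)%:Z)%R.

Definition signed_perms : {set {perm letter}} :=
  [set s : {perm letter} | [forall x, s (neg x) == neg (s x)]].

Definition signed_perms_le (r : 'I_n -> nat) : {set {perm letter}} :=
  [set s in signed_perms | [forall k, (`|ival (s (pos k))| <= r k)%N]].

Definition inv_B (s : {perm letter}) : nat :=
  #|[set p : 'I_n * 'I_n | (p.1 < p.2)%N &
       (ival (s (pos p.1)) > ival (s (pos p.2)))%R]|
  + #|[set p : 'I_n * 'I_n | (p.1 < p.2)%N &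
       (- ival (s (pos p.1)) > ival (s (pos p.2)))%R]|
  + #|[set i : 'I_n | (ival (s (pos i)) < 0)%R]|.

Definition Prlminl (s : {perm letter}) : {set 'I_n} :=
  [set (s (pos k)).2 | k : 'I_n &
     (0 < ival (s (pos k)))%R &&
     [forall l : 'I_n, (k < l)%N ==>
        (ival (s (pos k)) < `|ival (s (pos l))|)%R]].

(* A balanced cycle is an orbit of s whose elements have distinct absolute
   values; an unbalanced one contains the opposite of each of its elements. *)
Definition balanced (O : {set letter}) : bool :=
  [forall x in O, forall y in O, (x.2 == y.2) ==> (x == y)].

Definition Cyc0 (s : {perm letter}) : {set 'I_n} :=
  [set i | [exists O in porbits s,
     [&& balanced O, i \in [set x.2 | x in O]
       & [forall x in O, (i <= x.2)%N]]]].

End SignedPermutations.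

Section Paths.
Variable n : nat.

(* The steps of a path; true is a rise and false a fall. *)
Definition lpath := (n + n).-tuple bool.
Implicit Type D : lpath.

Definition rises D : {set 'I_(n + n)} := [set v | tnth D v].
Definition falls D : {set 'I_(n + n)} := [set v | ~~ tnth D v].

(* The number of rises (resp. falls) among the first m steps. *)
Definition nb_rises D (m : nat) : nat := #|[set v in rises D | (v < m)%N]|.
Definition nb_falls D (m : nat) : nat := #|[set v in falls D | (v < m)%N]|.

Definition is_dyck D : Prop :=
  #|rises D| = n /\ forall m : nat, (nb_falls D m <= nb_rises D m)%N.

(* The positions of the rises and falls, in increasing order; the default
   value of nth is irrelevant when D has n rises and n falls. *)
Definition opener D (k : 'I_n) : 'I_(n + n) :=
  nth (lshift n k) (enum (rises D)) k.
Definition closer D (k : 'I_n) : 'I_(n + n) :=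
  nth (lshift n k) (enum (falls D)) k.

(* The subtraction does not truncate when D is a Dyck path. *)
Definition height D (k : 'I_n) : nat :=
  nb_rises D (opener D k).+1 - nb_falls D (opener D k).+1.

(* The k-th fall, being preceded by r k rises and k falls, is the step r k + k
   (0-based); see dyck_of_dyck, dyck_of_rises and dyck_of_unique. *)
Definition dyck_of (r : 'I_n -> nat) : lpath :=
  [tuple ~~ [exists k : 'I_n, v == r k + k :> nat] | v < n + n].

Lemma rank_nth_enum (m : nat) (A : {set 'I_m}) (x0 : 'I_m) (k : nat) :
  (k < #|A|)%N -> #|[set w in A | (w < nth x0 (enum A) k)%N]| = k.
Proof.
move=> kA; have sA : size (enum A) = #|A| by rewrite -cardE.
have srt : sorted ltn (map val (enum A)).
  rewrite sorted_map {1}/enum_mem.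
  apply: sorted_filter; first by move=> ? ? ?; apply: ltn_trans.
  rewrite -enumT -sorted_map val_enum_ord; exact: iota_ltn_sorted.
have srtP i j : (i < #|A|)%N -> (j < #|A|)%N ->
    (nth x0 (enum A) i < nth x0 (enum A) j)%N = (i < j)%N.
  move=> iA jA.
  have := @lt_sorted_ltn_nth _ nat 0%N _ srt i j.
  rewrite !inE size_map sA => /(_ iA jA).
  by rewrite !(nth_map x0) ?sA.
have -> : [set w in A | (w < nth x0 (enum A) k)%N] =
          [set w in take k (enum A)].
  apply/setP=> w; rewrite !inE; apply/andP/idP => [[wA]|].
    move: (wA); rewrite -mem_enum => /(nthP x0)[i]; rewrite sA => iA <-.
    rewrite srtP // => ik; apply/(nthP x0); exists i.
      by rewrite size_take sA kA.
    by rewrite nth_take.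
  move=> /(nthP x0)[i]; rewrite size_take sA kA => ik <-.
  rewrite nth_take // srtP // ?(ltn_trans ik kA) //; split=> //.
  by rewrite -mem_enum mem_nth // sA (ltn_trans ik kA).
rewrite cardsE (card_uniqP _) ?take_uniq ?enum_uniq //.
by rewrite size_take sA kA.
Qed.

Lemma nth_enum_rank (m : nat) (A : {set 'I_m}) (x0 v : 'I_m) (k : nat) :
  v \in A -> #|[set w in A | (w < v)%N]| = k -> nth x0 (enum A) k = v.
Proof.
rewrite -mem_enum => /(nthP x0)[i]; rewrite -cardE => iA <-.
by rewrite rank_nth_enum // => ->.
Qed.

Lemma nb_risesD_falls D m : (m <= n + n)%N -> nb_rises D m + nb_falls D m = m.
Proof.
move=> lem; rewrite /nb_rises /nb_falls -cardsUI.
rewrite (_ : _ :&: _ = set0) ?cards0 ?addn0; last first.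
  by apply/setP=> v; rewrite !inE; case: (tnth D v); rewrite ?andbF.
rewrite (_ : _ :|: _ = [set widen_ord lem i | i : 'I_m]); last first.
  apply/setP=> v; rewrite !inE -andb_orl orbN /=.
  apply/idP/imsetP => [vm|[i _ ->] //=].
  by exists (Ordinal vm) => //; apply: val_inj.
by rewrite card_imset ?card_ord // => i j /(congr1 val) /= /val_inj.
Qed.

Lemma dyck_falls D : is_dyck D -> #|falls D| = n.
Proof.
move=> [nD _]; have -> : falls D = ~: rises D by apply/setP=> v; rewrite !inE.
by have := cardsC (rises D); rewrite nD card_ord => /addnI.
Qed.

Section DyckOf.
Variable r : 'I_n -> nat.
Hypothesis r_bounds : forall k : 'I_n, (1 <= r k <= n)%N.
Hypothesis r_mono : forall i j : 'I_n, (i <= j)%N -> (r i <= r j)%N.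
Hypothesis r_ge : forall k : 'I_n, (k.+1 <= r k)%N.

Let fall_lt (k : 'I_n) : (r k + k < n + n)%N.
Proof. by have := r_bounds k; have := ltn_ord k; lia. Qed.

Let fallo (k : 'I_n) : 'I_(n + n) := Ordinal (fall_lt k).

Let fallo_lt (i j : 'I_n) : (fallo i < fallo j)%N = (i < j)%N.
Proof.
rewrite /=; case: (ltnP i j) => ij.
  by have := r_mono (ltnW ij); lia.
by have := r_mono ij; lia.
Qed.

Let fallo_inj : injective fallo.
Proof.
move=> i j eij; apply: val_inj; have := fallo_lt i j; have := fallo_lt j i.
by rewrite eij ltnn; case: ltngtP.
Qed.

Let fallsE : falls (dyck_of r) = fallo @: setT.
Proof.
apply/setP=> v; rewrite !inE tnth_mktuple negbK.
apply/existsP/imsetP => [[k /eqP vk]|[k _ ->]].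
  by exists k => //; apply: val_inj.
by exists k.
Qed.

Let falls_lt (k : 'I_n) :
  [set w in falls (dyck_of r) | (w < fallo k)%N] =
  fallo @: [set j : 'I_n | (j < k)%N].
Proof.
rewrite fallsE; apply/setP=> w; rewrite inE.
apply/andP/imsetP => [[/imsetP[j _ ->]]|[j]].
  by rewrite fallo_lt => jk; exists j; rewrite ?inE.
by rewrite inE => jk ->; rewrite fallo_lt imset_f.
Qed.

Let card_lt (k : nat) : (k <= n)%N -> #|[set j : 'I_n | (j < k)%N]| = k.
Proof.
move=> kn; rewrite (_ : [set _ | _] = [set widen_ord kn i | i : 'I_k]).
  by rewrite card_imset ?card_ord // => i j /(congr1 val) /= /val_inj.
apply/setP=> v; rewrite !inE; apply/idP/imsetP => [vm|[i _ ->] //=].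
by exists (Ordinal vm) => //; apply: val_inj.
Qed.

Lemma dyck_of_closer (k : 'I_n) : closer (dyck_of r) k = r k + k :> nat.
Proof.
suff -> : closer (dyck_of r) k = fallo k by [].
apply: nth_enum_rank; first by rewrite fallsE imset_f.
by rewrite falls_lt card_imset // card_lt // ltnW.
Qed.

Lemma dyck_of_rises (k : 'I_n) :
  nb_rises (dyck_of r) (closer (dyck_of r) k) = r k.
Proof.
have vk := dyck_of_closer k.
have := @nb_risesD_falls (dyck_of r) (closer (dyck_of r) k) (ltnW (ltn_ord _)).
have -> : nb_falls (dyck_of r) (closer (dyck_of r) k) = k.
  rewrite /nb_falls vk -[r k + k]/(val (fallo k)) falls_lt card_imset //.
  by rewrite card_lt // ltnW.
by rewrite vk => /addIn.
Qed.

Lemma dyck_of_dyck : is_dyck (dyck_of r).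
Proof.
have cf : #|falls (dyck_of r)| = n.
  by rewrite fallsE card_imset // cardsT card_ord.
have cr : #|rises (dyck_of r)| = n.
  have -> : rises (dyck_of r) = ~: falls (dyck_of r).
    by apply/setP=> v; rewrite !inE negbK.
  by have := cardsC (falls (dyck_of r)); rewrite cf card_ord => /addnI.
split=> // m; case: (leqP m (n + n)) => mn; last first.
  suff -> : nb_rises (dyck_of r) m = n.
    by rewrite -[leqRHS]cf; apply/subset_leq_card/subsetP=> v; rewrite inE => /andP[].
  rewrite -[RHS]cr; apply: eq_card => v; rewrite !inE.
  by rewrite (ltn_trans (ltn_ord v) mn) andbT.
have := nb_risesD_falls (dyck_of r) mn.
suff : (2 * nb_falls (dyck_of r) m <= m)%N by lia.
suff : (nb_falls (dyck_of r) m <= m./2)%N by lia.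
case: (leqP n m./2) => nm.
  apply: leq_trans nm; rewrite -[leqRHS]cf.
  by apply/subset_leq_card/subsetP=> v; rewrite inE => /andP[].
rewrite -[leqRHS](card_lt (ltnW nm)) -(card_imset _ fallo_inj).
apply/subset_leq_card/subsetP=> v; rewrite inE fallsE => /andP[/imsetP[j _ ->]].
by move=> /= jm; rewrite imset_f // inE; have := r_ge j; lia.
Qed.

Lemma dyck_of_unique D :
  is_dyck D -> (forall k, nb_rises D (closer D k) = r k) -> D = dyck_of r.
Proof.
move=> dD Dr; have cD := dyck_falls dD.
have cloE (k : 'I_n) : closer D k = fallo k.
  apply: val_inj => /=.
  have := @nb_risesD_falls D (closer D k) (ltnW (ltn_ord _)).
  by rewrite Dr /nb_falls rank_nth_enum ?cD // => <-.
apply: eq_from_tnth => v; apply: negb_inj.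
have fE u : ~~ tnth u v = (v \in falls u) by rewrite inE.
rewrite !fE fallsE.
apply/idP/imsetP => [|[k _ ->]].
  rewrite -mem_enum => /(nthP v)[i]; rewrite -cardE cD => ik <-.
  exists (Ordinal ik) => //; rewrite -cloE /closer.
  by apply: set_nth_default; rewrite -cardE cD.
by rewrite -cloE -mem_enum mem_nth // -cardE cD.
Qed.

End DyckOf.
End Paths.

Section Matchings.
Variable n : nat.

(* A matching M is given by the map v |-> M(v), its edges being the pairs
   {v, M(v)}; colors are recorded at both ends of each edge, true being blue. *)
Record bmatching := BMatching {
  mate : 'I_(n + n) -> 'I_(n + n);
  col : 'I_(n + n) -> bool
}.

Definition bmatching_of_type (D : lpath n) (M : bmatching) : Prop :=
  [/\ forall v, mate M v != v,
      forall v, mate M (mate M v) = v,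
      forall v, col M (mate M v) = col M v
    & forall v : 'I_(n + n), (v < mate M v)%N = tnth D v].

Variable D : lpath n.
Implicit Type M : bmatching.

(* The step M_k |-> M_{k-1}. *)
Definition sort_step M0 (k : 'I_n) M : bmatching :=
  let o := opener D k in
  let c := mate M o in
  let c0 := mate M0 o in
  let x := mate M c0 in
  if c == c0 then
    BMatching (mate M) (fun v => if (v == o) || (v == c) then false else col M v)
  else
    BMatching
      (fun v => if v == o then c0 else if v == c0 then o
                else if v == x then c else if v == c then x else mate M v)
      (fun v => if (v == o) || (v == c0) then col M o (+) col M o
                else if (v == x) || (v == c) then col M x (+) col M o
                else col M v).

(* The matching from which the step at the opener o_k starts: foldr applies
   the steps at o_n, o_{n-1}, ..., down to the successor of o_k, to M. *)
Definition sort_seq M0 M (k : 'I_n) : bmatching :=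
  foldr (sort_step M0) M [seq j : 'I_n <- enum 'I_n | (k < j)%N].

Definition sor_a M0 (k : 'I_n) M : nat :=
  let o := opener D k in
  let c := mate M o in
  let c0 := mate M0 o in
  if (c <= c0)%N then
    #|[set v : 'I_(n + n) | [&& (o < v)%N, (c <= v <= c0)%N & (mate M0 v < o)%N]]|
  else
    #|[set v : 'I_(n + n) | [&& (o < v)%N, ~~ (c0 < v < c)%N & (mate M0 v < o)%N]]|.

Definition sor_k M M0 (k : 'I_n) : nat :=
  let Mk := sort_seq M0 M k in
  if col Mk (opener D k) then (2 * k.+1 - 1 - sor_a M0 k Mk)%N
  else sor_a M0 k Mk.

Definition sor M M0 : nat := (\sum_(k < n) sor_k M M0 k)%N.

End Matchings.

Section SorR.
Variables (n : nat) (r : 'I_n -> nat).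

(* The matching with edges o_|s(k)| . c_k, blue when s(k) < 0. *)
Definition g_r (s : {perm letter n}) : bmatching n :=
  let D := dyck_of r in
  let o k := opener D (s (pos k)).2 in
  let c k := closer D k in
  BMatching
    (fun v => if [pick k | v == c k] is Some k then o k
              else if [pick k | v == o k] is Some k then c k else v)
    (fun v => [exists k : 'I_n, ((v == c k) || (v == o k)) &&
                                (ival (s (pos k)) < 0)%R]).

Section GrType.
Hypothesis r_bounds : forall k : 'I_n, (1 <= r k <= n)%N.
Hypothesis r_mono : forall i j : 'I_n, (i <= j)%N -> (r i <= r j)%N.
Hypothesis r_ge : forall k : 'I_n, (k.+1 <= r k)%N.

Lemma g_r_of_type (s : {perm letter n}) :
  s \in signed_perms_le r -> bmatching_of_type (dyck_of r) (g_r s).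
Proof.
rewrite inE => /andP[]; rewrite inE => /forallP sB /forallP sr.
have dD := dyck_of_dyck r_bounds r_mono r_ge.
have [cR _] := dD; have cF := dyck_falls dD.
set D := dyck_of r in dD cR cF *.
pose p k := (s (pos k)).2; pose o k := opener D (p k); pose c k := closer D k.
have p_inj : injective p.
  move=> i j pij.
  case: (eqVneq (s (pos i)) (s (pos j))) => [/perm_inj[]//|nij].
  have : s (pos i) = s (neg (pos j)).
    move: nij pij; rewrite (eqP (sB _)) /p /neg.
    by case: (s _) => [[] a]; case: (s _) => [[] b] //= + e; rewrite e ?eqxx.
  by move=> /perm_inj.
have o_inj : injective o.
  move=> i j oij; apply: p_inj; apply: val_inj; move/eqP: oij.
  rewrite /o /opener (set_nth_default (lshift n (p j))) -?cardE ?cR //.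
  by rewrite nth_uniq ?enum_uniq -?cardE ?cR // => /eqP.
have c_inj : injective c.
  move=> i j cij; apply: val_inj; move/eqP: cij.
  rewrite /c /closer (set_nth_default (lshift n j)) -?cardE ?cF //.
  by rewrite nth_uniq ?enum_uniq -?cardE ?cF // => /eqP.
have oR k : tnth D (o k).
  have : o k \in rises D by rewrite -mem_enum mem_nth // -cardE cR.
  by rewrite inE.
have cFk k : ~~ tnth D (c k).
  have : c k \in falls D by rewrite -mem_enum mem_nth // -cardE cF.
  by rewrite inE.
have oc j k : (c j == o k) = false.
  by apply: contraNF (cFk j) => /eqP ->.
have olt k : (o k < c k)%N.
  have pr : (p k < r k)%N.
    have := sr k; rewrite /ival -/(p k); case: (s (pos k)).1; lia.
  rewrite ltnNge; apply: contraTN pr => cleo; rewrite -leqNgt.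
  rewrite -[leqLHS](dyck_of_rises r_bounds r_mono).
  have pk : (p k < #|rises D|)%N by rewrite cR.
  rewrite -[leqRHS](rank_nth_enum (lshift n (p k)) pk).
  apply/subset_leq_card/subsetP=> v; rewrite !inE => /andP[-> vc] /=.
  exact: leq_trans vc cleo.
have cov v : (exists k, v = o k) \/ (exists k, v = c k).
  case vD: (tnth D v); [left|right].
    have : v \in enum (rises D) by rewrite mem_enum inE.
    move=> /(nthP v)[i]; rewrite -cardE cR => iR <-.
    have /codomP[k ik] : Ordinal iR \in codom p by rewrite injF_onto.
    exists k; rewrite /o /opener -ik.
    by apply: set_nth_default; rewrite -cardE cR.
  have : v \in enum (falls D) by rewrite mem_enum inE vD.
  move=> /(nthP v)[i]; rewrite -cardE cF => iF <-.
  exists (Ordinal iF); rewrite /c /closer.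
  by apply: set_nth_default; rewrite -cardE cF.
have mc k : mate (g_r s) (c k) = o k.
  rewrite /=; case: pickP => [j /eqP /c_inj -> //|/(_ k)].
  by rewrite eqxx.
have mo k : mate (g_r s) (o k) = c k.
  rewrite /=; case: pickP => [j|_]; first by rewrite eq_sym -/(c j) oc.
  case: pickP => [j /eqP /o_inj -> //|/(_ k)].
  by rewrite -/(p k) -/(o k) eqxx.
split=> v; case: (cov v) => -[k ->]; rewrite ?mc ?mo ?mc ?mo //.
- by rewrite oc.
- by rewrite eq_sym oc.
- apply: eq_existsb => j; rewrite -/(o j) -/(c j).
  by rewrite (inj_eq c_inj) (inj_eq o_inj) [o k == c j]eq_sym !oc orbF.
- apply: eq_existsb => j; rewrite -/(o j) -/(c j).
  by rewrite (inj_eq c_inj) (inj_eq o_inj) [o k == c j]eq_sym !oc orbF.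
- by rewrite olt oR.
by rewrite (negPf (cFk k)); apply/negbTE; rewrite -leqNgt ltnW.
Qed.

End GrType.

Definition sor_r (s s0 : {perm letter n}) : nat :=
  sor (dyck_of r) (g_r s) (g_r s0).

End SorR.

Definition qint (R : comNzRingType) (q : R) (m : nat) : R :=
  (\sum_(i < m) q ^+ i)%R.

(* Main.v *)
Require Import Defs.
From mathcomp Require Import all_boot all_order all_algebra all_fingroup.
From mathcomp Require Import zify.
Import GRing.Theory Num.Theory.

Set Implicit Arguments.
Unset Strict Implicit.
Unset Printing Implicit Defensive.

(* Read a signed permutation off from its largest letter down.  Once the letters
   larger than k are placed, the letter k can go, with either sign, to any of the
   positions l with r_l >= k that are still free, and there are h_k of them.
   For inv_B, the letter k contributes b if it is positive and 2k - 1 - b if it is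
   negative, where b < h_k is the number of free positions to its right, and it
   lies in Prlminl iff it is positive and b = 0.  For sor, the k-th step multiplies
   s by a signed transposition of positions which moves the letter k to its place
   in s0, and the same contributions arise with b the cyclic distance, among the
   free positions, from the place of k to its place in s0; in s o s0^-1 the step
   removes k from its cycle, so k is the minimum of a balanced cycle iff it is a
   fixed point when its turn comes, that is iff it is positive and b = 0.
   Both codes s |-> (b, sign)_k are bijections from B_r onto the product of the
   sets [0, h_k) x {+, -}, so that both sums factor. *)

(** * Letters and signed permutations *)

Section Letters.
Variable n : nat.
Implicit Types (x y a b : letter n) (s : {perm letter n}).

Lemma negK : involutive (@neg n).
Proof. by case=> e i; rewrite /neg /= negbK. Qed.

Lemma neg_inj : injective (@neg n).
Proof. exact: inv_inj negK. Qed.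

Lemma neg_neq x : (neg x == x) = false.
Proof. by case: x => -[] i; apply/eqP => -[]. Qed.

Lemma eq_abs x y : x.2 = y.2 -> x = y \/ x = neg y.
Proof.
by case: x y => [[] i] [[] j] /= ->; rewrite /neg /=; [left|right|right|left].
Qed.

Lemma eq_abs_sign x y : x.2 = y.2 -> x.1 = y.1 -> x = y.
Proof. by case: x y => ? ? [? ?] /= -> ->. Qed.

Lemma abs_ival x : (`|ival x| = x.2.+1)%N.
Proof. by rewrite /ival; case: x.1; lia. Qed.

Lemma ival_gt0 x : (0 < ival x)%R = ~~ x.1.
Proof. by rewrite /ival; case: x.1; lia. Qed.

Lemma ival_lt0 x : (ival x < 0)%R = x.1.
Proof. by rewrite /ival; case: x.1; lia. Qed.

Lemma signed_permsP s :
  reflect (forall x, s (neg x) = neg (s x)) (s \in signed_perms n).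
Proof. by rewrite inE; apply: (iffP forallP) => sB x; apply/eqP. Qed.

Section SignedPerm.
Variable s : {perm letter n}.
Hypothesis sB : s \in signed_perms n.

Lemma signed_permN x : s (neg x) = neg (s x).
Proof. exact: (signed_permsP _ sB). Qed.

Lemma signed_permV : s^-1%g \in signed_perms n.
Proof.
apply/signed_permsP=> x; apply: (@perm_inj _ s).
by rewrite signed_permN !permKV.
Qed.

Lemma signed_perm_abs x y : x.2 = y.2 -> (s x).2 = (s y).2.
Proof. by case/eq_abs => ->; rewrite ?signed_permN. Qed.

Lemma signed_perm_abs_inj x y : (s x).2 = (s y).2 -> x.2 = y.2.
Proof.
by case/eq_abs; [move/perm_inj->|rewrite -signed_permN => /perm_inj->].
Qed.

Lemma signed_perm_pos x :
  s (pos x.2) = if x.1 then neg (s x) else s x.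
Proof.
by case: x => -[] i //=; rewrite -signed_permN.
Qed.

Lemma perm_pos_inv (k : 'I_n) :
  s (pos ((s^-1)%g (pos k)).2) = (((s^-1)%g (pos k)).1, k).
Proof. by rewrite signed_perm_pos permKV; case: ((s^-1)%g (pos k)).1. Qed.

Lemma pos_inv_sign (k : 'I_n) :
  (forall i, ~~ (s (pos i)).1) -> ((s^-1)%g (pos k)).1 = false.
Proof. by move=> /(_ ((s^-1)%g (pos k)).2)/negPf; rewrite perm_pos_inv. Qed.

End SignedPerm.

Lemma signed_permM s s' :
  s \in signed_perms n -> s' \in signed_perms n -> (s * s')%g \in signed_perms n.
Proof.
by move=> sB sB'; apply/signed_permsP=> x; rewrite !permM !signed_permN.
Qed.

(* For b = a this is the identity, and for b = neg a it is the sign change at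
   the position of a. *)
Definition signed_swap a b x :=
  if x == a then b else if x == b then a
  else if x == neg a then neg b else if x == neg b then neg a else x.

Lemma signed_swapK a b : involutive (signed_swap a b).
Proof.
move=> x; rewrite /signed_swap.
have [->|xa] := eqVneq x a; first by rewrite eqxx; case: eqVneq.
have [->|xb] := eqVneq x b; first by rewrite eqxx.
have [xna|xna] := eqVneq x (neg a).
  rewrite neg_neq (inj_eq neg_inj) eqxx -(inj_eq neg_inj) negK -xna.
  by rewrite eq_sym (negPf xb); case: eqVneq => // ->.
have [xnb|xnb] := eqVneq x (neg b); last first.
  by rewrite (negPf xa) (negPf xb) (negPf xna) (negPf xnb).
rewrite neg_neq -(inj_eq neg_inj) negK -xnb eq_sym (negPf xa).
by rewrite eqxx.
Qed.

Definition stperm a b := perm (inv_inj (signed_swapK a b)).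

Lemma stpermE a b x : stperm a b x = signed_swap a b x.
Proof. by rewrite permE. Qed.

Lemma stpermK a b : involutive (stperm a b).
Proof. by move=> x; rewrite !stpermE signed_swapK. Qed.

Lemma stperm2 a b : (stperm a b * stperm a b = 1)%g.
Proof. by apply/permP=> x; rewrite permM stpermK perm1. Qed.

Lemma stperm11 a : stperm a a = 1%g.
Proof.
apply/permP=> x; rewrite stpermE perm1 /signed_swap.
by do 2!case: eqVneq => [-> //|_].
Qed.

Lemma stpermL a b : stperm a b a = b.
Proof. by rewrite stpermE /signed_swap eqxx. Qed.

Lemma stpermR a b : stperm a b b = a.
Proof. by rewrite -{2}(stpermL a b) stpermK. Qed.

Lemma stpermD a b x : x.2 != a.2 -> x.2 != b.2 -> stperm a b x = x.
Proof.
move=> xa xb; rewrite stpermE /signed_swap.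
have F (y : letter n) : x.2 != y.2 -> (x == y) = false.
  by move=> xy; apply: contraNF xy => /eqP ->.
by rewrite !F.
Qed.

Lemma stperm_signed a b : stperm a b \in signed_perms n.
Proof.
apply/signed_permsP=> x; rewrite !stpermE /signed_swap.
rewrite !(inj_eq neg_inj) !(inv_eq negK).
have Nneq y : (y == neg y) = false by rewrite eq_sym neg_neq.
have [->|xa] := eqVneq x a.
  by rewrite Nneq; case: eqVneq.
have [->|xb] := eqVneq x b.
  by rewrite Nneq; case: eqVneq.
by do 2![case: (x == neg _); rewrite ?negK //].
Qed.

End Letters.

(** * Ranks in a finite set of positions *)

Section Rank.
Variable n : nat.
Implicit Types (A : {set 'I_n}) (p : 'I_n).

Lemma card_sumb (T : finType) (A : {set T}) (P : pred T) :
  #|[set l in A | P l]| = \sum_(l in A) P l.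
Proof.
rewrite -sum1_card (eq_bigl (fun l => (l \in A) && P l)); last first.
  by move=> l; rewrite inE.
by rewrite big_mkcondr; apply: eq_bigr => l _; case: (P l).
Qed.

Definition rank A p := \sum_(l in A) (l < p).
Definition rank_after A p := \sum_(l in A) (p < l).

(* The distance from p to p0 when the elements of A are arranged in a circle
   in increasing order. *)
Definition rank_cyc A p0 p :=
  \sum_(l in A) (if p <= p0 then p <= l < p0 else ~~ (p0 <= l < p)).

Lemma rank_lt A p : p \in A -> rank A p < #|A|.
Proof.
move=> pA; rewrite /rank -sum1_card (bigD1 p) //= ltnn add0n.
rewrite [X in _ < X](bigD1 p) //= add1n ltnS.
by apply: leq_sum => l _; case: (l < p).
Qed.

Lemma rank_mono A p p' : p \in A -> p < p' -> rank A p < rank A p'.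
Proof.
move=> pA pp'; rewrite /rank (bigD1 p) //= ltnn add0n.
rewrite [X in _ < X](bigD1 p) //= pp' add1n ltnS.
by apply: leq_sum => l _; lia.
Qed.

Lemma rank_inj A p p' : p \in A -> p' \in A -> rank A p = rank A p' -> p = p'.
Proof.
move=> pA pA' e; apply: val_inj => /=.
by case: (ltngtP p p') => // /rank_mono; [move/(_ _ pA)|move/(_ _ pA')]; rewrite e ltnn.
Qed.

Lemma rank_afterE A p : p \in A -> rank_after A p + rank A p + 1 = #|A|.
Proof.
move=> pA; rewrite -sum1_card /rank_after /rank -big_split /=.
rewrite (bigD1 p) //= [in RHS](bigD1 p) //= ltnn addn0 add0n addn1 add1n; congr _.+1.
by apply: eq_bigr => l /andP[_ lp]; move: lp; rewrite -val_eqE /=; lia.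
Qed.

(** Without wrap-around the elements from [p] up to [p0] are counted directly; with it, one counts
    the complement of the stretch from [p0] up to [p]. Bounds and injectivity then become arithmetic
    on ranks. *)
Lemma rank_cycE A p0 p : p \in A -> p0 \in A ->
  rank_cyc A p0 p =
    if p <= p0 then rank A p0 - rank A p else #|A| - rank A p + rank A p0.
Proof.
move=> pA p0A; rewrite /rank_cyc; case: leqP => pp0.
  suff -> : rank A p0 = \sum_(l in A) (p <= l < p0) + rank A p by rewrite addnK.
  by rewrite /rank -big_split /=; apply: eq_bigr => l _; lia.
suff : \sum_(l in A) ~~ (p0 <= l < p) + rank A p = #|A| + rank A p0.
  by have := rank_lt pA; lia.
by rewrite -sum1_card /rank -!big_split /=; apply: eq_bigr => l _; lia.
Qed.

Lemma rank_cyc_lt A p0 p : p \in A -> p0 \in A -> rank_cyc A p0 p < #|A|.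
Proof.
move=> pA p0A; rewrite rank_cycE //; have := rank_lt p0A.
by case: (leqP p p0) => [_|/(rank_mono p0A)]; have := rank_lt pA; lia.
Qed.

Lemma rank_cyc_inj A p0 : p0 \in A -> {in A &, injective (rank_cyc A p0)}.
Proof.
move=> p0A p p' pA pA'; rewrite !rank_cycE // => e; apply: (rank_inj pA pA').
have := rank_lt pA; have := rank_lt pA'; have := rank_lt p0A.
have le0 l : l \in A -> l <= p0 -> rank A l <= rank A p0.
  move=> lA; rewrite leq_eqVlt => /orP[/eqP/val_inj->//|/(rank_mono lA)].
  exact: ltnW.
move: e (le0 p pA) (le0 p' pA').
by case: (leqP p p0) => [pp0|/(rank_mono p0A)];
   case: (leqP p' p0) => [pp0'|/(rank_mono p0A)]; lia.
Qed.

Lemma rank_cyc_eq0 A p0 p :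
  p \in A -> p0 \in A -> (rank_cyc A p0 p == 0) = (p == p0).
Proof.
move=> pA p0A; have e0 : rank_cyc A p0 p0 = 0.
  by rewrite rank_cycE // leqnn subnn.
apply/eqP/eqP => [|-> //]; rewrite -e0; exact: rank_cyc_inj.
Qed.

Lemma rank_cyc_onto A p0 b :
  p0 \in A -> b < #|A| -> exists2 p, p \in A & rank_cyc A p0 p = b.
Proof.
move=> p0A bA.
(* Pigeonhole: an injective map from [A] to a set of size [#|A|] is onto. The default of [insubd] is
   never reached on [A]. *)
pose f p : 'I_#|A| := insubd (Ordinal bA) (rank_cyc A p0 p).
have fE p : p \in A -> f p = rank_cyc A p0 p :> nat.
  by move=> pA; rewrite val_insubd rank_cyc_lt.
have: Ordinal bA \in f @: A.
  suff -> : f @: A = setT by rewrite inE.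
  apply/eqP; rewrite eqEcard subsetT cardsT card_ord card_in_imset ?leqnn //.
  move=> p p' pA pA' /(congr1 val) /=; rewrite !fE //; exact: rank_cyc_inj.
by case/imsetP=> p pA /(congr1 val) /=; rewrite fE // => ->; exists p.
Qed.

End Rank.

(** * Signed permutations with the same large letters *)

Section Agree.
Variables (n : nat) (r : 'I_n -> nat).
Implicit Types (x a b : letter n) (s : {perm letter n}).

Lemma signed_perms_leP s :
  reflect (s \in signed_perms n /\ forall x, (s x).2 < r x.2)
          (s \in signed_perms_le r).
Proof.
rewrite [X in reflect _ X]inE; apply: (iffP andP) => -[sB].
  move=> /forallP sr; split=> // x.
  by rewrite (@signed_perm_abs _ _ sB x (pos x.2)) // -abs_ival.
by move=> sr; split=> //; apply/forallP=> k; rewrite abs_ival sr.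
Qed.

(** The free positions open to the letter [m] once all larger letters are placed. Letters are
    0-based, so the bound on absolute values at [l] admits [m] exactly when [m < r l]. *)
Definition avail s (m : nat) : {set 'I_n} :=
  [set l | (m < r l) && ((s (pos l)).2 <= m)].

Lemma mem_avail s m x : s \in signed_perms n ->
  (x.2 \in avail s m) = (m < r x.2) && ((s x).2 <= m).
Proof. by move=> sB; rewrite inE (@signed_perm_abs _ _ sB (pos x.2) x). Qed.

(** The letters of index at least [m] have the same signed positions in both permutations; this is
    the invariant of the sorting algorithm. *)
Definition agree s0 s (m : nat) := forall x, m <= (s0 x).2 -> s x = s0 x.

Section AgreeTheory.
Variables s0 s : {perm letter n}.
Variable m : nat.
Hypothesis ag : agree s0 s m.

Lemma agree_sym : agree s s0 m.
Proof.
move=> x mx; have := ag (x := (s0^-1)%g (s x)). rewrite permKV => /(_ mx).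
by move=> /perm_inj e; rewrite -[in LHS]e permKV.
Qed.

Lemma agree_lt x : ((s x).2 < m) = ((s0 x).2 < m).
Proof.
by apply/idP/idP; apply: contraTT; rewrite -!leqNgt => mx;
   [rewrite ag|rewrite agree_sym].
Qed.

Lemma agreeS : agree s0 s m.+1.
Proof. by move=> x mx; apply: ag; apply: ltnW. Qed.

End AgreeTheory.

Lemma agree_n s0 s : agree s0 s n.
Proof. by move=> x; rewrite leqNgt ltn_ord. Qed.

Lemma agree0 s0 s : agree s0 s 0 -> s = s0.
Proof. by move=> ag; apply/permP => x; apply: ag. Qed.

Lemma avail_agree s0 s m : agree s0 s m.+1 -> avail s m = avail s0 m.
Proof.
by move=> ag; apply/setP=> l; rewrite !inE; congr (_ && _); apply: (agree_lt ag).
Qed.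

Lemma agree_pred s0 s (k : 'I_n) :
  s0 \in signed_perms n -> s \in signed_perms n ->
  agree s0 s k.+1 -> s ((s0^-1)%g (pos k)) = pos k -> agree s0 s k.
Proof.
move=> s0B sB ag sk x; rewrite leq_eqVlt => /orP[/eqP/val_inj|/ag //].
move=> /(@eq_abs _ (pos k) (s0 x))[] e.
  by rewrite -e -sk e permK.
by move: sk; rewrite e signed_permN ?signed_permV // permK signed_permN // => /neg_inj.
Qed.

Lemma swap_agree s0 s a b m :
  s0 \in signed_perms n -> agree s0 s m ->
  (s0 a).2 < m -> (s0 b).2 < m -> agree s0 (stperm a b * s)%g m.
Proof.
move=> s0B ag am bm x mx; rewrite permM stpermD ?ag //; apply/eqP.
  by move/(signed_perm_abs s0B) => e; move: am; rewrite -e ltnNge mx.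
by move/(signed_perm_abs s0B) => e; move: bm; rewrite -e ltnNge mx.
Qed.

(** Both positions admit the letter [m] and carry letters of index at most [m], so exchanging their
    contents respects the bounds [r]. *)
Lemma swap_le s a b m : s \in signed_perms_le r ->
  a.2 \in avail s m -> b.2 \in avail s m -> (stperm a b * s)%g \in signed_perms_le r.
Proof.
case/signed_perms_leP=> sB sr; rewrite !mem_avail // => /andP[mra sam] /andP[mrb sbm].
apply/signed_perms_leP; rewrite signed_permM ?stperm_signed //; split=> // x.
rewrite permM; set T := stperm a b.
have TB : T \in signed_perms n by apply: stperm_signed.
have [xa|xa] := eqVneq x.2 a.2.
  rewrite (signed_perm_abs sB (signed_perm_abs TB xa)) stpermL xa.
  exact: leq_ltn_trans mra.
have [xb|xb] := eqVneq x.2 b.2.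
  rewrite (signed_perm_abs sB (signed_perm_abs TB xb)) stpermR xb.
  exact: leq_ltn_trans mrb.
by rewrite stpermD.
Qed.

Lemma avail_pos s (k : 'I_n) :
  s \in signed_perms_le r -> ((s^-1)%g (pos k)).2 \in avail s k.
Proof.
case/signed_perms_leP=> sB sr; rewrite mem_avail // permKV leqnn andbT.
by have := sr ((s^-1)%g (pos k)); rewrite permKV.
Qed.

Lemma card_abs_lt s m : s \in signed_perms n -> m <= n ->
  #|[set l | (s (pos l)).2 < m]| = m.
Proof.
move=> sB mn; pose p l := (s (pos l)).2.
have p_inj : injective p by move=> i j /(signed_perm_abs_inj sB).
rewrite (_ : [set _ | _] = p @^-1: [set i : 'I_n | i < m]); last first.
  by apply/setP=> l; rewrite !inE.
rewrite card_preimset // -sum1_card (eq_bigl (fun i : 'I_n => i < m)).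
  by rewrite (big_ord_narrow mn) big_const_ord iter_addn_0 mul1n.
by move=> i; rewrite inE.
Qed.

(** The [k.+1] positions carrying letters of index at most [k] include every [l] with [r l <= k];
    the others are the available ones. Hence [#|avail r s k|] does not depend on [s]. *)
Lemma card_avail s (k : 'I_n) : s \in signed_perms_le r ->
  #|avail s k| + #|[set l | r l <= k]| = k.+1.
Proof.
case/signed_perms_leP=> sB sr.
have -> : [set l | r l <= k] = [set l | (r l <= k) && ((s (pos l)).2 <= k)].
  apply/setP=> l; rewrite !inE; case: leqP => //= rlk.
  by rewrite (leq_trans _ rlk) // ltnW // (sr (pos l)).
rewrite -[RHS](card_abs_lt sB (ltn_ord k)).
rewrite -(cardsID [set l | k < r l] [set l | (s (pos l)).2 < k.+1]).
by congr (_ + _); apply: eq_card => l; rewrite !inE -?leqNgt // andbC.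
Qed.

End Agree.

(** * Sums over a product of code sets *)

Section Codes.
Variables (n : nat) (T : finType) (B : {set T}) (h : 'I_n -> nat).
Variable C : T -> 'I_n -> nat * bool.
Hypothesis h_le : forall k, h k <= n.
Hypothesis C_lt : forall s k, s \in B -> (C s k).1 < h k.
Hypothesis C_inj : {in B &, forall s s', C s =1 C s' -> s = s'}.

(** All values lie in the single finite type ['I_n.+1], which is never empty, so that [inord]
    applies and codes form a finite function type. *)
Definition codes : {set {ffun 'I_n -> 'I_n.+1 * bool}} :=
  [set f : {ffun 'I_n -> 'I_n.+1 * bool} | [forall k, (f k).1 < h k]].

Definition fcode s : {ffun 'I_n -> 'I_n.+1 * bool} :=
  [ffun k => (inord (C s k).1, (C s k).2)].

Lemma fcodeE s k : s \in B -> (fcode s k).1 = (C s k).1 :> nat.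
Proof.
by move=> sB; rewrite ffunE inordK // ltnS ltnW // (leq_trans (C_lt k sB)).
Qed.

Lemma fcode_inj : {in B &, injective fcode}.
Proof.
move=> s s' sB sB' /ffunP e; apply: C_inj => // k.
apply: injective_projections; first by rewrite -!fcodeE // e.
by have := congr1 snd (e k); rewrite !ffunE.
Qed.

Lemma fcode_sub : fcode @: B \subset codes.
Proof.
apply/subsetP=> _ /imsetP[s sB ->]; rewrite inE; apply/forallP=> k.
by rewrite fcodeE // C_lt.
Qed.

(** One surjective code is enough to count [B]; any other injective code with the same bounds is
    then onto by cardinality. *)
Lemma card_codes :
    (forall c : 'I_n -> nat * bool, (forall k, (c k).1 < h k) ->
       exists2 s, s \in B & C s =1 c) ->
  #|B| = #|codes|.
Proof.
move=> onto; rewrite -(card_in_imset fcode_inj); congr #|pred_of_set _|.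
apply/eqP; rewrite eqEsubset fcode_sub; apply/subsetP=> f.
rewrite inE => /forallP fh.
have [|s sB sf] := onto (fun k => ((f k).1 : nat, (f k).2)); first exact: fh.
apply/imsetP; exists s => //; apply/ffunP=> k; rewrite ffunE sf /=.
by rewrite inord_val; case: (f k).
Qed.

Lemma sum_codes (R : comNzRingType) (w : 'I_n -> nat -> bool -> R) :
  #|B| = #|codes| ->
  (\sum_(s in B) \prod_k w k (C s k).1 (C s k).2 =
   \prod_k (\sum_(i < h k) w k i false + \sum_(i < h k) w k i true))%R.
Proof.
move=> cB; have imB : fcode @: B = codes.
  by apply/eqP; rewrite eqEcard fcode_sub (card_in_imset fcode_inj) cB leqnn.
pose F k (x : 'I_n.+1 * bool) := w k x.1 x.2.
transitivity (\sum_(f in codes) \prod_k F k (f k))%R.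
  rewrite -imB big_imset /=; last exact: fcode_inj.
  apply: eq_bigr => s sB; apply: eq_bigr => k _.
  by rewrite /F fcodeE // ffunE.
(* Codes form a family of independent choices, so the sum of products is a product of sums by
   distributivity. *)
rewrite (eq_bigl (fun f : {ffun 'I_n -> 'I_n.+1 * bool} =>
  f \in family (fun k => [pred x : 'I_n.+1 * bool | x.1 < h k]))); last first.
  by move=> f; rewrite inE; apply/forallP/familyP.
rewrite -bigA_distr_big_dep; apply: eq_bigr => k _.
have hk : h k <= n.+1 by apply: leqW.
rewrite !(big_ord_widen _ (fun i => w k i _) hk) -big_split /=.
transitivity (\sum_(i < n.+1 | (i < h k)%N) \sum_(e : bool) F k (i, e))%R.
  by rewrite pair_big; apply: eq_big => [[i e]|[i e] _] //=; rewrite andbT.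
by apply: eq_bigr => i _; rewrite big_bool addrC.
Qed.

End Codes.

Lemma ord_down_ind n (P : nat -> Prop) :
  P n -> (forall k : 'I_n, P k.+1 -> P k) -> forall m, m <= n -> P m.
Proof.
move=> Pn PS m mn; rewrite -(subKn mn); elim: (n - m) (leq_subr m n) => [|d IH] dn.
  by rewrite subn0.
have lt : n - d.+1 < n by lia.
by apply: (PS (Ordinal lt)); rewrite /= -subSn // subSS; apply: IH; apply: ltnW.
Qed.

(** * The sorting algorithm on signed permutations *)

Section Stage.
Variables (n : nat) (s0 : {perm letter n}).
Implicit Types (s : {perm letter n}) (k : 'I_n).

Lemma filter_enum_ord k :
  [seq j : 'I_n <- enum 'I_n | k <= j] = k :: [seq j : 'I_n <- enum 'I_n | k < j].
Proof.
apply: (inj_map val_inj) => /=.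
rewrite -!(filter_map val (fun j => _ <= j)) val_enum_ord.
have -> : iota 0 n = iota 0 k ++ (k : nat) :: iota k.+1 (n - k.+1).
  by rewrite -[_ :: _]/(iota k (n - k.+1).+1) -iotaD; congr (iota 0 _);
     have := ltn_ord k; lia.
rewrite !filter_cat /= leqnn ltnn.
have F (c : nat) : k <= c -> [seq j <- iota 0 k | c <= j] = [::].
  move=> kc; apply/eqP; rewrite -(negbK (_ == _)) -has_filter.
  by apply/hasPn=> j; rewrite mem_iota; lia.
rewrite !F //=; congr (_ :: _); apply: eq_in_filter => j.
by rewrite mem_iota; lia.
Qed.

(** The swap acts on positions, before [s], and brings the letter [k] to its place in [s0]. If [k]
    is there with the wrong sign, the swap is a mere sign change. *)
Definition sstep k s := (stperm ((s0^-1)%g (pos k)) ((s^-1)%g (pos k)) * s)%g.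

Definition stage m s := foldr sstep s [seq j : 'I_n <- enum 'I_n | m <= j].

Lemma stage_n s : stage n s = s.
Proof.
rewrite /stage (@eq_filter _ _ pred0) ?filter_pred0 // => j.
by rewrite leqNgt ltn_ord.
Qed.

Lemma stageE k s : stage k s = sstep k (stage k.+1 s).
Proof. by rewrite /stage filter_enum_ord. Qed.

Lemma stage_eq s s' m j : j <= m -> m <= n ->
  stage m s = stage m s' -> stage j s = stage j s'.
Proof.
move=> jm mn e; rewrite -(subKn jm).
elim: (m - j) (leq_subr j m) => [|d IH] dm; first by rewrite subn0.
have lt : m - d.+1 < n by lia.
rewrite -[m - d.+1]/(val (Ordinal lt)) !stageE /= -subSn // subSS IH //.
exact: ltnW.
Qed.

Definition sor_pos s k := ((stage k.+1 s)^-1)%g (pos k).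

(** The swap is an involution, so a step can be undone as soon as the signed position of [k] before
    it is known. *)
Lemma stage_step s k :
  stage k.+1 s = (stperm ((s0^-1)%g (pos k)) (sor_pos s k) * stage k s)%g.
Proof. by rewrite stageE mulgA stperm2 mul1g. Qed.

End Stage.

Section Sort.
Variables (n : nat) (r : 'I_n -> nat) (s0 : {perm letter n}).
Hypothesis s0_in : s0 \in signed_perms_le r.
Implicit Types (s : {perm letter n}) (k : 'I_n).

Let s0B : s0 \in signed_perms n.
Proof. by case/signed_perms_leP: s0_in. Qed.

Lemma agree_avail s k :
  s \in signed_perms_le r -> agree s0 s k.+1 ->
  ((s^-1)%g (pos k)).2 \in avail r s0 k.
Proof. by move=> s_in /(avail_agree r) <-; apply: avail_pos. Qed.

Lemma avail_abs_lt x k : x.2 \in avail r s0 k -> (s0 x).2 < k.+1.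
Proof. by rewrite mem_avail // => /andP[]. Qed.

Lemma sstep_in s k : s \in signed_perms_le r -> agree s0 s k.+1 ->
  sstep s0 k s \in signed_perms_le r /\ agree s0 (sstep s0 k s) k.
Proof.
move=> s_in ag.
have a0 := avail_pos k s0_in; have a1 := agree_avail s_in ag.
have st_in : sstep s0 k s \in signed_perms_le r.
  by apply: (@swap_le _ _ _ _ _ k) => //; rewrite (avail_agree r ag).
split=> //; apply: agree_pred => //.
- by case/signed_perms_leP: st_in.
- by apply: swap_agree => //; apply: avail_abs_lt.
by rewrite permM stpermL permKV.
Qed.

Lemma stage_in s m : s \in signed_perms_le r -> m <= n ->
  stage s0 m s \in signed_perms_le r /\ agree s0 (stage s0 m s) m.
Proof.
move=> s_in; move: m; apply: ord_down_ind => [|k [st_in ag]].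
  by rewrite stage_n; split=> //; apply: agree_n.
by rewrite stageE; apply: sstep_in.
Qed.

Lemma stage0 s : s \in signed_perms_le r -> stage s0 0 s = s0.
Proof. by move=> s_in; case: (stage_in s_in (leq0n n)) => _ /agree0. Qed.

Lemma stage_agree s m : s \in signed_perms_le r -> m <= n -> agree s0 s m ->
  stage s0 m s = s.
Proof.
move=> s_in; move: m; apply: ord_down_ind => [_|k IH ag]; first exact: stage_n.
rewrite stageE (IH (agreeS ag)) /sstep.
suff -> : (s0^-1)%g (pos k) = (s^-1)%g (pos k) by rewrite stperm11 mul1g.
apply: (@perm_inj _ s); rewrite permKV ag ?permKV //.
Qed.

(** When [k] has its turn, the larger letters stand as in [s0], so the free positions can be taken
    from [s0] and do not vary with [s]. *)
Definition sor_code s k : nat * bool :=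
  (rank_cyc (avail r s0 k) ((s0^-1)%g (pos k)).2 (sor_pos s0 s k).2,
   (sor_pos s0 s k).1).

Lemma sor_pos_avail s k : s \in signed_perms_le r ->
  (sor_pos s0 s k).2 \in avail r s0 k.
Proof.
by move=> s_in; case: (stage_in s_in (ltn_ord k)) => st_in /agree_avail->.
Qed.

Lemma sor_code_lt s k : s \in signed_perms_le r ->
  (sor_code s k).1 < #|avail r s0 k|.
Proof.
by move=> s_in; apply: rank_cyc_lt; rewrite ?avail_pos ?sor_pos_avail.
Qed.

Lemma sor_code_inj :
  {in signed_perms_le r &, forall s s', sor_code s =1 sor_code s' -> s = s'}.
Proof.
move=> s s' s_in s'_in e.
(* The algorithm is run backwards from its common end [s0] at stage 0; each code entry determines
   the step to be undone. *)
suff E m : m <= n -> stage s0 m s = stage s0 m s'.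
  by rewrite -(stage_n s0 s) -(stage_n s0 s') E.
elim: m => [|m IH] mn; first by rewrite !stage0.
have := e (Ordinal mn); case=> e1 e2.
rewrite -[m]/(val (Ordinal mn)) !stage_step /= IH ?(ltnW mn) //.
congr (stperm _ _ * _)%g; apply: eq_abs_sign => //.
by apply: rank_cyc_inj e1; rewrite ?sor_pos_avail ?avail_pos.
Qed.

Lemma sor_code_onto (c : 'I_n -> nat * bool) :
    (forall k, (c k).1 < #|avail r s0 k|) ->
  exists2 s, s \in signed_perms_le r & sor_code s =1 c.
Proof.
(* The permutation is built from [s0] by undoing steps, smallest letter first: the entries below [m]
   are right, and the letters from [m] on still stand as in [s0]. *)
move=> c_lt; suff /(_ n (leqnn n))[s [s_in _ sc]] : forall m, m <= n -> exists s,
    [/\ s \in signed_perms_le r, agree s0 s m &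
        forall k : 'I_n, k < m -> sor_code s k = c k].
  by exists s => // k; rewrite sc.
elim=> [|m IH] mn; first by exists s0; split.
have [s [s_in ag sc]] := IH (ltnW mn).
pose k := Ordinal mn; have a0 := avail_pos k s0_in.
have [p pA pc] := rank_cyc_onto a0 (c_lt k).
pose b : letter n := ((c k).2, p); pose a := (s0^-1)%g (pos k).
pose s' := (stperm a b * s)%g.
have ag1 := agreeS ag.
have s'_in : s' \in signed_perms_le r.
  by apply: (@swap_le _ _ _ _ _ k); rewrite ?(avail_agree r ag1).
have ag' : agree s0 s' m.+1.
  by apply: swap_agree => //; apply: (@avail_abs_lt _ k).
have sa : s a = pos k by rewrite ag /a permKV.
have s'k : (s'^-1)%g (pos k) = b.
  by apply: (@perm_inj _ s'); rewrite permKV permM stpermR sa.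
(* The steps above [k] leave [s'] alone and the step at [k] gives back [s], so the entries below [k]
   are those of [s]. *)
have st : stage s0 k s' = s.
  rewrite stageE (stage_agree s'_in) // /sstep s'k.
  by rewrite mulgA stperm2 mul1g.
exists s'; split=> // j; rewrite ltnS leq_eqVlt => /orP[/eqP jk|jm].
  have -> : j = k by apply: val_inj.
  rewrite /sor_code /sor_pos (stage_agree s'_in) // s'k /= pc.
  by case: (c k).
rewrite -sc // /sor_code /sor_pos.
suff -> : stage s0 j.+1 s' = stage s0 j.+1 s by [].
by apply: (stage_eq jm (ltnW mn)); rewrite [LHS]st (stage_agree s_in) // ltnW.
Qed.

End Sort.

(** * Type B inversions and right-to-left minima *)

Section InvCode.
Variables (n : nat) (r : 'I_n -> nat).
Implicit Types (s : {perm letter n}) (k : 'I_n).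

Definition inv_code s k : nat * bool :=
  (rank_after (avail r s k) ((s^-1)%g (pos k)).2, ((s^-1)%g (pos k)).1).

Lemma inv_code_lt s k : s \in signed_perms_le r ->
  (inv_code s k).1 < #|avail r s k|.
Proof. by move=> s_in; rewrite -(rank_afterE (avail_pos k s_in)) /=; lia. Qed.

(** Letters are recovered from the largest down: once those above [k] agree, so do the available
    sets, and the number of available positions to the right fixes the position of [k]. *)
Lemma inv_code_inj :
  {in signed_perms_le r &, forall s s', inv_code s =1 inv_code s' -> s = s'}.
Proof.
move=> s s' s_in s'_in e; apply: agree0; move: (leq0n n); move: 0.
case/signed_perms_leP: (s_in) => sB _; case/signed_perms_leP: (s'_in) => s'B _.
apply: ord_down_ind => [|k ag]; first exact: agree_n.
apply: agree_pred => //; have [] := e k.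
rewrite (avail_agree r ag) => e1 e2.
suff -> : (s'^-1)%g (pos k) = (s^-1)%g (pos k) by rewrite permKV.
apply: eq_abs_sign => //; have := avail_pos k s_in; have := avail_pos k s'_in.
rewrite (avail_agree r ag) => p'A pA; apply: (rank_inj p'A pA).
by have := rank_afterE p'A; rewrite -(rank_afterE pA) e1 => /addIn/addnI.
Qed.

End InvCode.

Section InvStat.
Variables (n : nat) (r : 'I_n -> nat).
Hypothesis r_mono : forall i j : 'I_n, i <= j -> r i <= r j.
Variable s : {perm letter n}.
Hypothesis s_in : s \in signed_perms_le r.

Let sB : s \in signed_perms n.
Proof. by case/signed_perms_leP: s_in. Qed.
Let sr x : (s x).2 < r x.2.
Proof. by case/signed_perms_leP: s_in. Qed.

Let X i := s (pos i).

(** By monotonicity of [r], every position to the right of [i] admits the letter at [i], so only the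
    comparison of absolute values remains. *)
Lemma rank_after_avail (i : 'I_n) :
  rank_after (avail r s (X i).2) i = \sum_(l : 'I_n) ((i < l) && ((X l).2 < (X i).2)).
Proof.
rewrite /rank_after big_mkcond; apply: eq_bigr => l _; rewrite inE.
case: (ltnP i l) => il; rewrite /= ?if_same //.
have -> : (X i).2 < r l by rewrite (leq_trans (sr (pos i))) // r_mono // ltnW.
rewrite /= -/(X l) leq_eqVlt; case: eqP => [/val_inj e|_] /=.
  by have := signed_perm_abs_inj sB e => /= li; rewrite li ltnn in il.
by case: ltnP.
Qed.

Lemma sum_abs_lt (i : 'I_n) :
  \sum_(l : 'I_n) ((i < l) && ((X l).2 < (X i).2)) +
  \sum_(l : 'I_n) ((l < i) && ((X l).2 < (X i).2)) = (X i).2.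
Proof.
rewrite -[RHS](card_abs_lt sB (ltnW (ltn_ord _))) -sum1_card -big_split [RHS]big_mkcond.
apply: eq_bigr => l _; rewrite inE -/(X l).
have [->|] := eqVneq l i; first by rewrite !ltnn.
rewrite -val_eqE /=; case: ((X l).2 < _); rewrite ?andbT ?andbF //; lia.
Qed.

Lemma card_pairs (P : rel 'I_n) :
  #|[set p : 'I_n * 'I_n | P p.1 p.2]| = \sum_i \sum_j P i j.
Proof.
rewrite -sum1_card pair_bigA big_mkcond /=; apply: eq_bigr => -[i j] _.
by rewrite inE; case: (P i j).
Qed.

(** Take positions [i < j]. If the left letter is larger in absolute value, exactly one of the two
    kinds of inversion occurs. Otherwise both occur when the right letter is negative, and none when
    it is positive. A negative letter [k] with [b] smaller ones to its right and [d] to its left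
    thus accounts for [b + 2d + 1], where [b + d = k]. *)
Lemma inv_B_code :
  inv_B s = \sum_k (if (inv_code r s k).2 then 2 * k.+1 - 1 - (inv_code r s k).1
                    else (inv_code r s k).1).
Proof.
pose b (i : 'I_n) := \sum_(l : 'I_n) ((i < l) && ((X l).2 < (X i).2)).
pose d (i : 'I_n) := \sum_(l : 'I_n) ((l < i) && ((X l).2 < (X i).2)).
transitivity (\sum_i (b i + (X i).1 * (d i).*2 + (X i).1)).
  rewrite /inv_B (card_pairs (fun i j : 'I_n =>
    (i < j) && (ival (X i) > ival (X j))%R)).
  rewrite (card_pairs (fun i j : 'I_n => (i < j) && (- ival (X i) > ival (X j))%R)).
  rewrite -sum1_card [X in _ + X]big_mkcond big_split; congr (_ + _); last first.
    by apply: eq_bigr => i _; rewrite inE -/(X i) ival_lt0; case: (X i).1.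
  (* The double inversions are charged to the right end of a pair; exchanging the sums indexes them
     by the left end, like the other terms. *)
  have dE : \sum_i (X i).1 * (d i).*2 =
      \sum_(i : 'I_n) \sum_(j : 'I_n) (X j).1 * ((i < j) && ((X i).2 < (X j).2)).*2.
    rewrite exchange_big; apply: eq_bigr => i _; rewrite /d -mul2n !big_distrr.
    by apply: eq_bigr => l _; rewrite /= mul2n.
  rewrite [RHS]big_split /= dE -!big_split; apply: eq_bigr => i _ /=.
  rewrite -!big_split; apply: eq_bigr => j _ /=.
  case: (ltnP i j) => //= ij; last by rewrite muln0.
  have : (X i).2 != (X j).2.
    by apply: contraTneq ij => /(signed_perm_abs_inj sB) /= ->; rewrite ltnn.
  rewrite -val_eqE /ival; case: (X i) (X j) => [[] x] [[] y] /=; lia.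
(* From here on the sum runs over letters instead of positions. *)
rewrite (reindex_onto (fun k => ((s^-1)%g (pos k)).2) (fun i => (X i).2)) /=; last first.
  move=> i _; apply: (signed_perm_abs_inj sB (y := pos i)).
  by rewrite -(signed_perm_abs sB (x := (s^-1)%g (pos (X i).2))) // permKV.
apply: eq_big => [k|k _]; first by rewrite /X (perm_pos_inv sB) eqxx.
set i := (_ .2); have Xi : X i = (((s^-1)%g (pos k)).1, k) := perm_pos_inv sB k.
have := sum_abs_lt i; have := rank_after_avail i; rewrite -/(b i) -/(d i) Xi /=.
by move=> ->; case: (_ .1) => /=; lia.
Qed.

Lemma Prlminl_code k : (k \in Prlminl s) = (inv_code r s k == (0, false)).
Proof.
set i := ((s^-1)%g (pos k)).2.
have Xi : X i = (((s^-1)%g (pos k)).1, k) := perm_pos_inv sB k.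
have cE : (inv_code r s k).1 = \sum_(l : 'I_n) ((i < l) && ((X l).2 < (X i).2)).
  by rewrite -rank_after_avail Xi.
have -> : (inv_code r s k == (0, false)) =
          ((inv_code r s k).1 == 0) && ~~ (inv_code r s k).2.
  by case: (inv_code r s k) => a [] //=; rewrite xpair_eqE ?andbT ?andbF.
rewrite cE /= sum_nat_eq0.
apply/imsetP/andP=> [[j]|[/forallP i0 s1]].
  rewrite inE ival_gt0 -/(X j) => /andP[pj /forallP jl] kj.
  have ji : j = i.
    by apply: (signed_perm_abs_inj sB (x := pos j) (y := pos i));
       rewrite -!/(X _) Xi kj.
  rewrite ji in pj jl; split; last by rewrite Xi in pj.
  apply/forallP=> l; rewrite eqb0; case: ltnP => //= il; rewrite -leqNgt.
  have := jl l; rewrite il /= -/(X i) -/(X l) /ival (negPf pj).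
  by case: (X l).1; lia.
exists i; last by rewrite -/(X i) Xi.
rewrite inE ival_gt0 -/(X i) Xi s1 /=; apply/forallP=> l; apply/implyP=> il.
have := i0 l; rewrite eqb0 il /= -leqNgt Xi /= -/(X l) /ival /= (negPf s1).
rewrite leq_eqVlt => /orP[/eqP/val_inj|]; last by case: (X l).1; lia.
rewrite -[k]/((((s^-1)%g (pos k)).1, k) : letter n).2 -Xi => /(signed_perm_abs_inj sB) /= e.
by rewrite e ltnn in il.
Qed.

End InvStat.

(** * Balanced cycles *)

Section Cycles.
Variable n : nat.
Implicit Types (x y : letter n) (p : {perm letter n}).

Lemma signed_permX p i : p \in signed_perms n -> (p ^+ i)%g \in signed_perms n.
Proof.
move=> pB; elim: i => [|i IH]; last by rewrite expgS signed_permM.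
by apply/signed_permsP=> x; rewrite expg0 !perm1.
Qed.

Lemma mem_porbit_next p x : p x \in porbit p x.
Proof. by have := mem_porbit p 1 x; rewrite expg1. Qed.

Lemma porbitN p x y : p \in signed_perms n ->
  (neg y \in porbit p (neg x)) = (y \in porbit p x).
Proof.
move=> pB; apply/porbitP/porbitP => -[i yi]; exists i; last first.
  by rewrite yi signed_permN // signed_permX.
by apply: neg_inj; rewrite yi signed_permN // signed_permX.
Qed.

(** A balanced cycle and its negative are two orbits with the same absolute values, so the orbit can
    be chosen to contain [pos k] itself. *)
Lemma Cyc0P p (k : 'I_n) : p \in signed_perms n ->
  (k \in Cyc0 p) = (neg (pos k) \notin porbit p (pos k)) &&
                   [forall y in porbit p (pos k), k <= y.2].
Proof.
move=> pB; rewrite inE; apply/exists_inP/andP => [[O Op]|[nk ky]].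
  case/and3P=> bO /imsetP[x xO kx] /forall_inP leO.
  have {Op} OE : O = porbit p x.
    by case/imsetP: Op xO => y _ -> xy; apply/eqP; rewrite eq_porbit_mem porbit_sym.
  have nx : neg x \notin porbit p x.
    apply/negP=> nx; have /forall_inP/(_ x xO)/forall_inP := bO.
    by rewrite OE => /(_ _ nx)/implyP/(_ (eqxx _)); rewrite eq_sym neg_neq.
  have [] := @eq_abs _ x (pos k) (esym kx) => xk.
    by rewrite -xk nx; split=> //; apply/forall_inP=> y; rewrite -OE => /leO.
  have -> : pos k = neg x by rewrite xk negK.
  rewrite porbitN //; split.
    exact: nx.
  by apply/forall_inP=> y; rewrite -(negK y) porbitN // -OE => /leO.
exists (porbit p (pos k)); first exact: imset_f.
apply/and3P; split=> //; last by apply/imsetP; exists (pos k); rewrite ?porbit_id.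
(* Two opposite elements in the orbit of [pos k] would make it meet the orbit of [neg (pos k)],
   hence coincide with it. *)
apply/forall_inP=> x xk; apply/forall_inP=> y yk; apply/implyP=> /eqP xy.
have [-> //|xny] := eq_abs xy; case/negP: nk.
have yN : y \in porbit p (neg (pos k)) by rewrite -porbitN // negK -xny.
by rewrite porbit_sym -eq_porbit_mem in yN; rewrite -eq_porbit_mem (eqP yN) eq_porbit_mem.
Qed.

Section Remove.
Variables (p p' : {perm letter n}) (m : 'I_n).
Hypothesis pB : p \in signed_perms n.
Hypothesis rem1 : forall x, x.2 != m -> (p x).2 != m -> p' x = p x.
Hypothesis rem2 : forall x, x.2 != m -> (p x).2 = m -> p' x = p (p x).

(** Here [p'] is [p] with the letters of absolute value [m] cut out of their cycles. One jump skips
    them: if [p] preserved the absolute value [m], no other letter could reach it. *)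
Lemma return_abs x : x.2 != m -> (p x).2 = m -> (p (p x)).2 != m.
Proof.
move=> xm pxm; apply: contra_neq xm => e.
by rewrite -[in RHS]pxm; apply/esym/(signed_perm_abs_inj pB); rewrite e pxm.
Qed.

Lemma porbit_removed x y : x.2 != m -> y \in porbit p' x ->
  (y.2 != m) && (y \in porbit p x).
Proof.
move=> xm /porbitP[i ->]; elim: i => [|i /andP[IHm IH]].
  by rewrite expg0 perm1 xm porbit_id.
rewrite expgSr permM; set z := (p' ^+ i)%g x in IHm IH *.
have ez : porbit p x = porbit p z by apply/eqP; rewrite eq_porbit_mem porbit_sym.
have [pzm|pzm] := eqVneq (p z).2 m.
  rewrite rem2 // return_abs // ez.
  by have := mem_porbit p 2 z; rewrite expgS expg1 permM.
by rewrite rem1 // pzm ez mem_porbit_next.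
Qed.

Lemma porbit_remove x y : x.2 != m -> y.2 != m ->
  (y \in porbit p' x) = (y \in porbit p x).
Proof.
move=> xm ym; apply/idP/idP => [/(porbit_removed xm)/andP[]//|/porbitP[i]].
(* The induction goes back one step along the cycle of [p], or two when the predecessor has absolute
   value [m]. *)
elim/ltn_ind: i y ym => i IH y ym.
have step z : z.2 != m -> z \in porbit p' x -> p' z \in porbit p' x.
  move=> _ zx; have -> : porbit p' x = porbit p' z.
    by apply/eqP; rewrite eq_porbit_mem porbit_sym.
  exact: mem_porbit_next.
case: i IH => [|i] IH; first by rewrite expg0 perm1 => ->; apply: porbit_id.
rewrite expgSr permM => yE; set z := (p ^+ i)%g x in yE.
have [zm|zm] := eqVneq z.2 m; last first.
  by rewrite yE -rem1 -?yE //; apply: step => //; apply: (IH i).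
case: i IH @z zm yE => [|i] IH /=; first by rewrite expg0 perm1 => e; rewrite e eqxx in xm.
rewrite expgSr permM; set w := (p ^+ i)%g x => pwm yE.
have wm : w.2 != m.
  by apply: contra_neq ym => wm; rewrite yE (signed_perm_abs pB (y := w)) // pwm wm.
by rewrite yE -rem2 //; apply: step => //; apply: (IH i).
Qed.

Lemma Cyc0_remove (k : 'I_n) :
  p' \in signed_perms n -> k != m -> (k <= m) -> (k \in Cyc0 p') = (k \in Cyc0 p).
Proof.
move=> p'B km kle; rewrite !Cyc0P // porbit_remove //; congr (_ && _).
apply/forall_inP/forall_inP => leO y yO; have [-> //|ym] := eqVneq y.2 m.
  by apply: leO; rewrite porbit_remove.
by apply: leO; rewrite -porbit_remove.
Qed.

End Remove.

(** If [k] is minimal in its cycle, its image can only be [k] or its opposite, and the latter makes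
    the cycle unbalanced. *)
Lemma Cyc0_top p (k : 'I_n) : p \in signed_perms n ->
  (p (pos k)).2 <= k -> (k \in Cyc0 p) = (p (pos k) == pos k).
Proof.
move=> pB pk; rewrite Cyc0P //; apply/andP/eqP => [[nk /forall_inP leO]|pkk].
  have pkO : p (pos k) \in porbit p (pos k) by apply: mem_porbit_next.
  have /eq_abs[//|e] : (p (pos k)).2 = (pos k).2.
    by apply: val_inj; apply/eqP; rewrite eqn_leq pk leO.
  by rewrite -e pkO in nk.
have Ok y : y \in porbit p (pos k) -> y = pos k.
  case/porbitP=> i ->; elim: i => [|i IH]; first by rewrite expg0 perm1.
  by rewrite expgSr permM IH.
split; last by apply/forall_inP=> y /Ok->.
by apply/negP=> /Ok/eqP; rewrite neg_neq.
Qed.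

End Cycles.

(** * Cycles along the sorting algorithm *)

Section SortCycles.
Variables (n : nat) (r : 'I_n -> nat) (s0 : {perm letter n}).
Hypothesis s0_in : s0 \in signed_perms_le r.
Hypothesis s0_pos : forall k : 'I_n, ~~ (s0 (pos k)).1.
Implicit Types (s : {perm letter n}) (k m : 'I_n).

Let s0B : s0 \in signed_perms n.
Proof. by case/signed_perms_leP: s0_in. Qed.

(** Swapping positions cuts [m] out of the cycles of the quotient: a letter formerly sent to [m] now
    goes where [m] was sent. As [k < m], neither balancedness nor minimality of [k] is affected. *)
Lemma Cyc0_step s m k : s \in signed_perms_le r -> agree s0 s m.+1 -> k < m ->
  (k \in Cyc0 (s0^-1 * sstep s0 m s)%g) = (k \in Cyc0 (s0^-1 * s)%g).
Proof.
move=> s_in ag km; have [st_in _] := sstep_in s0_in s_in ag.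
have sB : s \in signed_perms n by case/signed_perms_leP: s_in.
have stB : sstep s0 m s \in signed_perms n by case/signed_perms_leP: st_in.
have abs_s0 x : x.2 != m -> ((s0^-1)%g x).2 != ((s0^-1)%g (pos m)).2.
  by apply: contra_neq => /(signed_perm_abs_inj (signed_permV s0B)).
apply: (@Cyc0_remove _ _ _ m); rewrite ?signed_permM ?signed_permV ?(ltnW km) //.
- move=> x xm; rewrite !permM => pxm; rewrite stpermD ?abs_s0 //.
  by apply: contra_neq pxm => /(signed_perm_abs sB); rewrite permKV.
- move=> x xm; rewrite !permM => pxm.
  have /(signed_perm_abs_inj sB)/eq_abs[] : (s ((s0^-1)%g x)).2 = (s ((s^-1)%g (pos m))).2.
    by rewrite permKV.
    by move->; rewrite stpermR permKV.
  move->; rewrite (signed_permN (stperm_signed _ _)) stpermR !(signed_permN sB) permKV.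
  by rewrite (signed_permN (signed_permV s0B)) (signed_permN sB).
- exact: stperm_signed.
- by apply: contraTneq km => ->; rewrite ltnn.
Qed.

(** The steps above [k] do not affect the membership of [k]. After them the quotient fixes all
    larger letters, so [Cyc0_top] applies. *)
Lemma Cyc0_code s k : s \in signed_perms_le r ->
  (k \in Cyc0 (s0^-1 * s)%g) = (sor_code r s0 s k == (0, false)).
Proof.
move=> s_in; transitivity (k \in Cyc0 (s0^-1 * stage s0 k.+1 s)%g).
  suff E (m : nat) : m <= n -> k < m ->
      (k \in Cyc0 (s0^-1 * stage s0 m s)%g) = (k \in Cyc0 (s0^-1 * s)%g).
    by rewrite -(E _ (ltn_ord k) (ltnSn k)).
  move: m; apply: ord_down_ind => [|m IH km]; first by rewrite stage_n.
  have [st_in ag] := stage_in s0_in s_in (ltn_ord m).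
  by rewrite stageE (Cyc0_step st_in ag km) IH // ltnW.
have [st_in ag] := stage_in s0_in s_in (ltn_ord k).
have stB : stage s0 k.+1 s \in signed_perms n by case/signed_perms_leP: st_in.
rewrite Cyc0_top ?signed_permM ?signed_permV //; last first.
  by rewrite permM -ltnS (agree_lt ag) permKV.
rewrite permM /sor_code xpair_eqE rank_cyc_eq0 ?sor_pos_avail ?avail_pos //.
apply/eqP/andP => [e|[/eqP e1 /eqP e2]].
  have -> : sor_pos s0 s k = (s0^-1)%g (pos k) by rewrite /sor_pos -{1}e permK.
  by rewrite (pos_inv_sign s0B _ s0_pos) !eqxx.
have <- : sor_pos s0 s k = (s0^-1)%g (pos k).
  by apply: eq_abs_sign; rewrite // (pos_inv_sign s0B _ s0_pos).
by rewrite permKV.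
Qed.

End SortCycles.

(** * Bicolored matchings *)

Section Path.
Variables (n : nat) (r : 'I_n -> nat).
Hypothesis r_bounds : forall k : 'I_n, 1 <= r k <= n.
Hypothesis r_mono : forall i j : 'I_n, i <= j -> r i <= r j.
Hypothesis r_ge : forall k : 'I_n, k.+1 <= r k.

Local Notation D := (dyck_of r).
Local Notation o := (opener D).
Local Notation c := (closer D).

Let dD : is_dyck D := dyck_of_dyck r_bounds r_mono r_ge.
Let cR : #|rises D| = n := proj1 dD.
Let cF : #|falls D| = n := dyck_falls dD.

Lemma opener_rises j : o j \in rises D.
Proof. by rewrite -mem_enum mem_nth // -cardE cR. Qed.

Lemma closer_falls j : c j \in falls D.
Proof. by rewrite -mem_enum mem_nth // -cardE cF. Qed.

Lemma closer_opener l j : (c l == o j) = false.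
Proof.
by apply: contraTF (opener_rises j) => /eqP <-; have := closer_falls l; rewrite !inE.
Qed.

Lemma closer_lt (i j : 'I_n) : (c i < c j) = (i < j).
Proof.
rewrite !dyck_of_closer //; case: (ltnP i j) => ij.
  by have := r_mono (ltnW ij); lia.
by have := r_mono ij; lia.
Qed.

Lemma closer_le (i j : 'I_n) : (c i <= c j) = (i <= j).
Proof. by rewrite leqNgt closer_lt -leqNgt. Qed.

Lemma closer_inj : injective c.
Proof.
move=> i j e; apply: val_inj; apply/eqP.
by rewrite eqn_leq -!closer_le e leqnn.
Qed.

Lemma rank_opener j : nb_rises D (o j) = j.
Proof. by rewrite /nb_rises rank_nth_enum // cR. Qed.

Lemma nb_rises_opener j : nb_rises D (o j).+1 = j.+1.
Proof.
rewrite -[in RHS](rank_opener j) /nb_rises.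
rewrite [in LHS](_ : [set v in _ | _] = o j |: [set v in rises D | v < o j]).
  by rewrite cardsU1 !inE ltnn andbF.
apply/setP=> v; rewrite !inE ltnS leq_eqVlt val_eqE.
by case: eqVneq => [->|] //=; rewrite ?andbT; have := opener_rises j; rewrite inE.
Qed.

Lemma nb_rises_mono a b : a <= b -> nb_rises D a <= nb_rises D b.
Proof.
move=> ab; apply/subset_leq_card/subsetP=> v; rewrite !inE => /andP[-> va].
exact: leq_trans ab.
Qed.

(** Positions are compared through the number of rises before them: [j] before the opener and [r l]
    before the closer. *)
Lemma opener_lt_closer (j l : 'I_n) : (o j < c l) = (j < r l).
Proof.
have H := dyck_of_rises r_bounds r_mono l; apply/idP/idP => [/nb_rises_mono|].
  by rewrite nb_rises_opener H.
by apply: contraTT; rewrite -!leqNgt => /nb_rises_mono; rewrite H rank_opener.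
Qed.

Lemma opener_lt (i j : 'I_n) : (o i < o j) = (i < j).
Proof.
apply/idP/idP => [/nb_rises_mono|]; first by rewrite nb_rises_opener rank_opener.
by apply: contraTT; rewrite -!leqNgt => /nb_rises_mono; rewrite !rank_opener.
Qed.

Lemma opener_inj : injective o.
Proof. by move=> i j e; apply: val_inj; rewrite /= -rank_opener e rank_opener. Qed.

Lemma opener_or_closer v : (exists j, v = o j) \/ (exists l, v = c l).
Proof.
have [vR|vF] := boolP (v \in rises D); [left|right].
  move: vR; rewrite -mem_enum => /(nthP v)[i]; rewrite -cardE cR => iR <-.
  by exists (Ordinal iR); apply: set_nth_default; rewrite -cardE cR.
have : v \in falls D by rewrite !inE in vF *.
rewrite -mem_enum => /(nthP v)[i]; rewrite -cardE cF => iF <-.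
by exists (Ordinal iF); apply: set_nth_default; rewrite -cardE cF.
Qed.

(** The falls before the opener of [k] are the closers [c l] with [r l <= k]; [card_avail] turns the
    difference into a number of positions. *)
Lemma height_avail s k : s \in signed_perms_le r -> height D k = #|avail r s k|.
Proof.
move=> s_in; rewrite /height nb_rises_opener -(card_avail k s_in).
suff -> : nb_falls D (o k).+1 = #|[set l | r l <= k]| by rewrite addnK.
rewrite -(card_imset _ closer_inj); apply: eq_card => v; rewrite inE ltnS.
apply/andP/imsetP => [[vF vo]|[l]]; last first.
  by rewrite inE => rl ->; rewrite closer_falls leqNgt opener_lt_closer -leqNgt.
case: (opener_or_closer v) => -[l vE].
  by have := opener_rises l; rewrite inE in vF; rewrite inE -vE (negPf vF).
by exists l; rewrite // inE; rewrite vE leqNgt opener_lt_closer -leqNgt in vo.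
Qed.

(* M is determined by this property, but only up to pointwise equality of the
   two functions which it consists of. *)
Definition represents (M : bmatching n) (s : {perm letter n}) :=
  forall l, [/\ mate M (c l) = o (s (pos l)).2, mate M (o (s (pos l)).2) = c l,
    Defs.col M (c l) = (s (pos l)).1 & Defs.col M (o (s (pos l)).2) = (s (pos l)).1].

Lemma g_r_represents s : s \in signed_perms n -> represents (g_r r s) s.
Proof.
move=> sB l; have oE (i j : 'I_n) : (o (s (pos i)).2 == o (s (pos j)).2) = (i == j).
  apply/eqP/eqP => [/opener_inj/(signed_perm_abs_inj sB)//|->//].
split=> /=.
- by case: pickP => [k /eqP/closer_inj <-//|/(_ l)]; rewrite eqxx.
- case: pickP => [k|_]; first by rewrite eq_sym closer_opener.
  by case: pickP => [k|/(_ l)]; rewrite oE ?eqxx // => /eqP->.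
- apply/existsP/idP => [[k]|sl]; last by exists l; rewrite eqxx ival_lt0 sl.
  by rewrite closer_opener orbF (inj_eq closer_inj) ival_lt0 => /andP[/eqP->].
apply/existsP/idP => [[k]|sl]; last by exists l; rewrite eqxx orbT ival_lt0 sl.
by rewrite eq_sym closer_opener oE ival_lt0 => /andP[/eqP->].
Qed.

Section Step.
Variables (s0 s : {perm letter n}) (M0 M : bmatching n).
Hypothesis s0B : s0 \in signed_perms n.
Hypothesis s0_pos : forall k : 'I_n, ~~ (s0 (pos k)).1.
Hypothesis sB : s \in signed_perms n.
Hypothesis M0P : represents M0 s0.
Hypothesis MP : represents M s.

Let p0 (k : 'I_n) := ((s0^-1)%g (pos k)).2.
Let p (k : 'I_n) := ((s^-1)%g (pos k)).2.

Lemma mate_represents u N k : u \in signed_perms n -> represents N u ->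
  mate N (o k) = c ((u^-1)%g (pos k)).2 /\ Defs.col N (o k) = ((u^-1)%g (pos k)).1.
Proof.
move=> uB NP; have [_ + _ +] := NP ((u^-1)%g (pos k)).2.
by rewrite signed_perm_pos // permKV; case: (((u^-1)%g (pos k)).1) => /=.
Qed.

Lemma sstep_pos k l : sstep s0 k s (pos l) =
  if l == p0 k then pos k
  else if l == p k then (((s^-1)%g (pos k)).1 (+) (s (pos (p0 k))).1, (s (pos (p0 k))).2)
  else s (pos l).
Proof.
rewrite /sstep; have := pos_inv_sign s0B k s0_pos; rewrite /p0 /p.
case: ((s0^-1)%g (pos k)) => _ i /= ->; case bE: ((s^-1)%g (pos k)) => [e j] /=.
have sb : s (e, j) = pos k by rewrite -bE permKV.
rewrite permM; have [->|li] := eqVneq l i; first by rewrite stpermL.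
have [->|lj] := eqVneq l j; last by rewrite stpermD.
case: e {bE sb} => /=; last by rewrite stpermR; case: (s _).
rewrite -[pos j]/(neg (true, j)) (signed_permN (stperm_signed _ _)) stpermR.
by rewrite signed_permN.
Qed.

Lemma sort_step_represents k : represents (sort_step D M0 k M) (sstep s0 k s).
Proof.
move=> l; rewrite sstep_pos.
have [m0 _] := mate_represents k s0B M0P; have [m1 c1] := mate_represents k sB MP.
have [mx _ _ cx] := MP (p0 k); have [ml ol cl dl] := MP l.
have absE i j : (o (s (pos i)).2 == o (s (pos j)).2) = (i == j).
  by rewrite (inj_eq opener_inj); apply/eqP/eqP => [/(signed_perm_abs_inj sB)|->].
have kE i : (o (s (pos i)).2 == o k) = (i == p k).
  by rewrite -(absE i (p k)) (perm_pos_inv sB).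
have oc j i : (o j == c i) = false by rewrite eq_sym closer_opener.
rewrite /sort_step m1 m0 -/(p0 k) -/(p k) (inj_eq closer_inj).
(* If [k] is already at its place, only the color of its edge is reset. Otherwise the letter it
   displaces moves to the old place of [k], its sign multiplied by that of [k], which is the
   addition of colors. *)
have [pp|pp] := eqVneq (p k) (p0 k).
  have [lp|lp] /= := eqVneq l (p0 k).
    have mk : mate M (c (p k)) = o k.
      by have [-> _ _ _] := MP (p k); rewrite (perm_pos_inv sB).
    by rewrite lp -pp mk m1 !eqxx !orbT.
  by rewrite pp (negPf lp) !oc closer_opener kE (inj_eq closer_inj) pp (negPf lp).
rewrite mx /=; have [->|lp0] := eqVneq l (p0 k).
  by rewrite /= closer_opener !eqxx /= addbb.
have [->|lp] := eqVneq l (p k).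
  rewrite /= !closer_opener !oc !(inj_eq closer_inj) (negPf pp) !eqxx kE eq_sym (negPf pp).
  by rewrite /= cx c1 addbC.
by rewrite !closer_opener !oc !(inj_eq closer_inj) (negPf lp) (negPf lp0) kE absE
  (negPf lp) (negPf lp0).
Qed.

Lemma sor_a_represents k : s0 \in signed_perms_le r ->
  sor_a D M0 k M = rank_cyc (avail r s0 k) (p0 k) (p k).
Proof.
move=> s0_in; have [_ s0r] := signed_perms_leP r s0 s0_in.
have [m0 _] := mate_represents k s0B M0P; have [m1 _] := mate_represents k sB MP.
rewrite /sor_a m0 m1 -/(p0 k) -/(p k) closer_le /rank_cyc.
have p0E l : ((s0 (pos l)).2 < k) = ((s0 (pos l)).2 <= k) && (l != p0 k).
  rewrite ltn_neqAle andbC; congr (_ && ~~ _).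
  apply/eqP/eqP=> [/val_inj e|->].
    by apply: (signed_perm_abs_inj s0B (x := pos l)); rewrite e permKV.
  rewrite signed_perm_pos // permKV; by case: (_ .1).
(* The vertices counted are closers of available positions other than [p0 k], whose partner in [M0]
   is the opener of [k] itself. Leaving out [p0 k] reconciles the intervals of [sor_a] with the
   half-open ones of [rank_cyc]. *)
have imE (P : pred 'I_(n + n)) (Q : pred 'I_n) :
    (forall l, P (c l) && (l != p0 k) = Q l) ->
  #|[set v : 'I_(n + n) | [&& o k < v, P v & mate M0 v < o k]]| =
  \sum_(l in avail r s0 k) Q l.
  move=> PQ; rewrite -card_sumb -(card_imset _ closer_inj); apply: eq_card => v.
  rewrite inE; apply/and3P/imsetP => [[ov Pv]|[l]].
    case: (opener_or_closer v) ov Pv => -[l ->] ov Pv.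
      have [-> _] := mate_represents l s0B M0P; set l' := (_ .2) => lo.
      (* An opener to the right of that of [k] has its partner still further right, so it is not
         counted. *)
      have : o l < c l'.
        by rewrite opener_lt_closer; have := s0r ((s0^-1)%g (pos l)); rewrite permKV.
      by move/ltn_trans/(_ lo); rewrite ltnNge (ltnW ov).
    have [-> _ _ _] := M0P l; rewrite opener_lt p0E => /andP[sl lp].
    by exists l => //; rewrite !inE -PQ Pv lp sl -opener_lt_closer ov.
  rewrite !inE -PQ => /andP[/andP[rl sl] /andP[Pl lp]] ->.
  have [-> _ _ _] := M0P l; rewrite opener_lt p0E sl lp opener_lt_closer rl.
  by split.
case: leqP => pp.
  by apply: imE => l; rewrite !closer_le -val_eqE /=; lia.
by apply: imE => l; rewrite !closer_lt -val_eqE /=; lia.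
Qed.

End Step.

End Path.

(** * The sorting index read off from the code *)

Section SorStat.
Variables (n : nat) (r : 'I_n -> nat).
Hypothesis r_bounds : forall k : 'I_n, 1 <= r k <= n.
Hypothesis r_mono : forall i j : 'I_n, i <= j -> r i <= r j.
Hypothesis r_ge : forall k : 'I_n, k.+1 <= r k.
Variables s0 s : {perm letter n}.
Hypothesis s0_in : s0 \in signed_perms_le r.
Hypothesis s0_pos : forall k : 'I_n, ~~ (s0 (pos k)).1.
Hypothesis s_in : s \in signed_perms_le r.

Let s0B : s0 \in signed_perms n.
Proof. by case/signed_perms_leP: s0_in. Qed.
Let sB : s \in signed_perms n.
Proof. by case/signed_perms_leP: s_in. Qed.

Lemma sort_seq_represents k :
  represents r (sort_seq (dyck_of r) (g_r r s0) (g_r r s) k) (stage s0 k.+1 s).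
Proof.
have M0P := g_r_represents r_bounds r_mono r_ge s0B.
rewrite /sort_seq /stage; set l := [seq _ <- _ | _].
suff [] : foldr (sstep s0) s l \in signed_perms n /\
  represents r (foldr (sort_step (dyck_of r) (g_r r s0)) (g_r r s) l)
               (foldr (sstep s0) s l) by [].
elim: l => [|j l [IHB IH]] /=; first by split=> //; apply: g_r_represents.
split; first by rewrite signed_permM ?stperm_signed.
exact: sort_step_represents.
Qed.

Lemma sor_r_code :
  sor_r r s s0 = \sum_k (if (sor_code r s0 s k).2
    then 2 * k.+1 - 1 - (sor_code r s0 s k).1 else (sor_code r s0 s k).1).
Proof.
apply: eq_bigr => k _; rewrite /sor_k.
have M0P := g_r_represents r_bounds r_mono r_ge s0B.
have MP := sort_seq_represents k.
have [st_in _] := stage_in s0_in s_in (ltn_ord k).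
have stB : stage s0 k.+1 s \in signed_perms n by case/signed_perms_leP: st_in.
have [_ ->] := mate_represents k stB MP.
by rewrite (sor_a_represents r_bounds r_mono r_ge s0B stB M0P MP).
Qed.

End SorStat.

(** * Weights of code entries and their sums *)

Section Factor.
Local Open Scope ring_scope.

Definition weight (R : comNzRingType) (q t : R) (k b : nat) (e : bool) : R :=
  q ^+ (if e then 2 * k.+1 - 1 - b else b)%N
  * (if (b, e) == (0%N, false) then t else 1).

(** Among positive choices, [b = 0] gives [t] and the others the powers from [q] to [q ^+ (h - 1)].
    The negative ones, read in reverse order, give the [h] consecutive powers starting at
    [q ^+ (2 * k.+1 - h)]. *)
Lemma sum_weight (R : comNzRingType) (q t : R) (k h : nat) : (0 < h <= k.+1)%N ->
  \sum_(b < h) weight q t k b false + \sum_(b < h) weight q t k b true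
  = t + q * qint q (h - 1) + q ^+ (2 * k.+1 - h) * qint q h.
Proof.
case: h => // h hk; rewrite subSS subn0 /weight /qint; congr (_ + _).
  rewrite big_ord_recl /= expr0 mul1r; congr (_ + _).
  by rewrite big_distrr; apply: eq_bigr => i _; rewrite /= mulr1 exprS.
rewrite big_distrr (reindex_inj rev_ord_inj); apply: eq_bigr => i _ /=.
rewrite ?xpair_eqE ?andbF mulr1 -exprD; congr (q ^+ _).
by have := ltn_ord i; lia.
Qed.

Lemma prod_weight (R : comNzRingType) (q : R) (n : nat) (t : 'I_n -> R)
    (C : 'I_n -> nat * bool) (A : {set 'I_n}) :
  (forall k, (k \in A) = (C k == (0%N, false))) ->
  q ^+ (\sum_k (if (C k).2 then 2 * k.+1 - 1 - (C k).1 else (C k).1))%N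
    * \prod_(i in A) t i
  = \prod_k weight q (t k) k (C k).1 (C k).2.
Proof.
move=> AC; rewrite expr_sum [X in _ * X]big_mkcond -big_split; apply: eq_bigr => k _ /=.
by rewrite /weight AC; case: (C k).
Qed.

End Factor.

Local Open Scope ring_scope.

(* perm multiplication is (s * u) x = u (s x), so the composite of functions
   sigma o sigma0^-1 is (sigma0^-1 * sigma)%g. *)
Theorem corollary3p10 (R : comNzRingType) (q : R) (n : nat) (t : 'I_n -> R)
    (r : 'I_n -> nat)
    (r_bounds : forall k : 'I_n, (1 <= r k <= n)%N)
    (r_mono : forall i j : 'I_n, (i <= j)%N -> (r i <= r j)%N)
    (r_ge : forall k : 'I_n, (k.+1 <= r k)%N)
    (sigma0 : {perm letter n})
    (sigma0_in : sigma0 \in signed_perms_le r)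
    (sigma0_pos : forall k : 'I_n, 0 < ival (sigma0 (pos k))) :
  \sum_(sigma in signed_perms_le r)
     q ^+ sor_r r sigma sigma0 * \prod_(i in Cyc0 (sigma0^-1 * sigma)%g) t i
  = \sum_(sigma in signed_perms_le r)
     q ^+ inv_B sigma * \prod_(i in Prlminl sigma) t i
  /\
  \sum_(sigma in signed_perms_le r)
     q ^+ inv_B sigma * \prod_(i in Prlminl sigma) t i
  = \prod_(k < n)
     (t k + q * qint q (height (dyck_of r) k - 1)
          + q ^+ (2 * k.+1 - height (dyck_of r) k)
            * qint q (height (dyck_of r) k)).
Proof.
have s0_pos k : ~~ (sigma0 (pos k)).1 by rewrite -ival_gt0.
pose h k := height (dyck_of r) k.
have hE s k : s \in signed_perms_le r -> h k = #|avail r s k|.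
  exact: height_avail.
have h_bounds k : (0 < h k <= k.+1)%N.
  rewrite (hE _ _ sigma0_in); apply/andP; split.
    by apply/card_gt0P; exists ((sigma0^-1)%g (pos k)).2; apply: avail_pos.
  by rewrite -(card_avail k sigma0_in) leq_addr.
have h_le k : (h k <= n)%N.
  by have /andP[_ hk] := h_bounds k; apply: leq_trans hk (ltn_ord k).
have sor_lt s k : s \in signed_perms_le r -> ((sor_code r sigma0 s k).1 < h k)%N.
  by move=> s_in; rewrite (hE _ _ sigma0_in); apply: sor_code_lt.
have inv_lt s k : s \in signed_perms_le r -> ((inv_code r s k).1 < h k)%N.
  by move=> s_in; rewrite (hE _ _ s_in); apply: inv_code_lt.
have sor_inj := sor_code_inj sigma0_in.
(* The count is obtained from the sorting code, where surjectivity is proved, and serves for the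
   inversion code as well. *)
have cardB : #|signed_perms_le r| = #|codes h|.
  apply: (card_codes h_le sor_lt sor_inj) => c c_lt.
  by apply: sor_code_onto => // k; rewrite -(hE _ _ sigma0_in).
pose w k := weight q (t k) k.
have factorE : \prod_(k < n) (\sum_(b < h k) w k b false + \sum_(b < h k) w k b true)
  = \prod_(k < n) (t k + q * qint q (h k - 1) + q ^+ (2 * k.+1 - h k) * qint q (h k)).
  by apply: eq_bigr => k _; apply: sum_weight.
have invE : \sum_(s in signed_perms_le r) q ^+ inv_B s * \prod_(i in Prlminl s) t i
    = \prod_(k < n) (t k + q * qint q (h k - 1) + q ^+ (2 * k.+1 - h k) * qint q (h k)).
  rewrite -factorE -(sum_codes h_le inv_lt (@inv_code_inj _ r) w cardB).
  apply: eq_bigr => s s_in; rewrite (inv_B_code r_mono s_in).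
  by apply: prod_weight => k; apply: Prlminl_code.
split=> //; rewrite invE -factorE -(sum_codes h_le sor_lt sor_inj w cardB).
apply: eq_bigr => s s_in; rewrite (sor_r_code r_bounds r_mono r_ge sigma0_in s0_pos s_in).
by apply: prod_weight => k; apply: Cyc0_code.
Qed.
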